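(* Let $d \in \mathbb N$, $d\ge 1$. The group of unitary maps on $\mathbb C^d$ is a maximal subsemigroup of $\operatorname{Aut}(\mathbb B_d)$.
   Context: $\mathbb B_d$ is the open unit ball in $\mathbb C^d$ ($d$ finite) and $\operatorname{Aut}(\mathbb B_d)$ is the group (under composition) of conformal automorphisms, i.e. biholomorphic self-maps, of $\mathbb B_d$. Unitary maps on $\mathbb C^d$ are regarded as elements of $\operatorname{Aut}(\mathbb B_d)$ by restriction to $\mathbb B_d$. A subsemigroup is a subset closed under composition. Maximality means: the group of unitaries is a proper subset, and every subsemigroup of $\operatorname{Aut}(\mathbb B_d)$ which properly contains it equals $\operatorname{Aut}(\mathbb B_d)$. *)

(* Defs.v *)
From HB Require Import structures.
From mathcomp Require Import all_boot all_order all_algebra.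
From mathcomp Require Import all_classical all_reals all_analysis.
From mathcomp Require Export complex.

Set Implicit Arguments.
Unset Strict Implicit.
Unset Printing Implicit Defensive.

Import Order.TTheory GRing.Theory Num.Theory.
Import numFieldNormedType.Exports.

Local Open Scope classical_set_scope.
Local Open Scope ring_scope.

(* The definitions are over an abstract numClosedFieldType C, because the
   library puts its topology and norm on abstract number fields; the intended
   instance is C := R[i] for R : realType. *)

Section UnitBall.
Variables (C : numClosedFieldType) (d : nat).

(* The library norm on 'cV[C]_d is the max norm, hence the explicit sum.  Both
   norms induce the same topology and the same differentiable maps. *)
Definition unit_ball : set 'cV[C]_d :=
  [set z | \sum_(i < d) `|z i 0| ^+ 2 < 1].

(* Self-maps of the ball have the subtype as domain, so that they are equal
   as soon as they agree on the ball. *)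
Definition ball_map : Type := set_type unit_ball -> set_type unit_ball.

(* [differentiable] is Fréchet differentiability over the scalar field C, i.e.
   complex differentiability.  The ball being open, the choice of F outside of
   the ball is irrelevant. *)
Definition holomorphic_ball_map (f : ball_map) : Prop :=
  exists F : 'cV[C]_d -> 'cV[C]_d,
    (forall z : set_type unit_ball, F (\val z) = \val (f z)) /\
    (forall z, unit_ball z -> differentiable F z).

Definition Aut_ball : set ball_map :=
  [set f | holomorphic_ball_map f /\
           exists g : ball_map,
             [/\ holomorphic_ball_map g, cancel f g & cancel g f]].

Definition unitary_ball_maps : set ball_map :=
  [set f | exists2 U : 'M[C]_d, U \is unitarymx &
           forall z : set_type unit_ball, \val (f z) = U *m \val z].

End UnitBall.

Arguments unit_ball C d _ : clear implicits.
Arguments ball_map C d : clear implicits.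
Arguments Aut_ball C d _ : clear implicits.
Arguments unitary_ball_maps C d _ : clear implicits.

Definition subsemigroup (T : Type) (G S : set (T -> T)) : Prop :=
  S `<=` G /\ forall f g, S f -> S g -> S (f \o g).

Definition maximal_subsemigroup (T : Type) (G M : set (T -> T)) : Prop :=
  [/\ subsemigroup G M,
      M `<` G &
      forall S, subsemigroup G S -> M `<` S -> S = G].

(* Main.v *)
Require Import Defs.
From mathcomp Require Import all_boot all_order all_algebra.
From mathcomp Require Import all_classical all_reals all_analysis.
From mathcomp Require Import ring lra.
Import Order.TTheory GRing.Theory Num.Theory.
Import numFieldNormedType.Exports Normc.

(** An automorphism of the ball that fixes the centre is unitary
    ([Aut_fixing_centre_unitary]).  For 0 <= t < 1 there is an explicit Moebius
    automorphism, [translation], that moves the centre to the point t e_0 of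
    the first coordinate axis.  Rotating f 0 onto that axis and translating it
    back to the centre therefore turns any automorphism f into a unitary map,
    which gives f = g o translation t o h with g and h unitary and t = |f 0|
    ([cartan_decomposition]).  Consequently a semigroup S of automorphisms that
    contains the unitary maps is determined by the set T of the numbers |f 0|,
    f in S, and T contains some t > 0 as soon as S contains a map that is not
    unitary.  If t is in T, the map translation t o D o translation t is in S
    for every rotation D of the first coordinate by a complex number u of
    modulus 1; as u runs through the circle, it moves the centre by all the
    distances from 0 (at u = -1) to 2t / (1 + t^2) (at u = 1), all of which are
    thus in T ([translation_doubling]).  The function t |-> 2t / (1 + t^2)
    pushes every t > 0 towards 1, so T = [0, 1) ([translation_all]) and S
    contains every automorphism.  Only products of elements of S occur in this
    argument, never inverses of elements of S that are not unitary; this is why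
    maximality holds among semigroups.

    That automorphisms fixing the centre are unitary is a consequence of the
    Schwarz lemma.  Holomorphy means differentiability at every point, with no
    continuity of the derivative, so the integral formula behind the Schwarz
    lemma has to come from Goursat's bisection argument ([goursat]).  It is
    used once: for a holomorphic self-map k of the disk with k 0 = 0, the
    function k (exp z) / exp z is holomorphic on the half-plane Re z < 0 and
    has period 2 i pi, so that its integral over a vertical segment of length
    2 pi does not depend on the segment.  Comparing the limits at both ends of
    the half-plane gives |k' 0| <= 1 ([normc_deriv0_le1]).  Moving other points
    of the disk to its centre yields the infinitesimal Schwarz-Pick inequality
    ([schwarz_pick]).  On a radius it says exactly that the function
    (Re (k t) - t) / (1 - t Re (k t)) of t is nonincreasing.  Hence
    Re (k t) <= t ([schwarz_Re]), and equality at one t forces equality at all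
    smaller ones ([schwarz_Re_rigid]).

    Let f be an automorphism with f 0 = 0.  Applied to the slices
    x |-> <f (x u), w> of f and of its inverse, the inequality shows that f
    preserves the norm; the rigidity then gives f (a z) = a (f z) for
    0 <= a <= 1, so that f coincides with its differential at 0, a linear map
    that preserves the norm. *)

Set Implicit Arguments.
Unset Strict Implicit.
Unset Printing Implicit Defensive.

Local Open Scope classical_set_scope.
Local Open Scope ring_scope.
Local Open Scope sesquilinear_scope.

(** * Pointwise derivatives *)

Section PointwiseDerivative.
Variable K : numFieldType.
Implicit Types (f g : K -> K) (z c : K).

(** An epsilon-delta form of [is_derive] that is free of topology: it still
    makes sense on R[i], whose topological structure is inferred only when the
    field is abstract. *)
Definition has_deriv f z c := forall e : K, 0 < e ->
  exists2 d : K, 0 < d &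
    forall h, `|h| < d -> `|f (z + h) - f z - c * h| <= e * `|h|.

Lemma has_derivP f z c : has_deriv f z c <-> is_derive z 1 f c.
Proof.
pose q h := h^-1 *: ((f \o shift z) (h *: (1 : K)) - f z).
have qE b h : h != 0 -> `|b - q h| * `|h| = `|f (z + h) - f z - b * h|.
  move=> h0; rewrite -normrM distrC; congr (`| _ |).
  rewrite /q /= /shift /= -[h *: 1]/(h * 1) mulr1 -[_ *: _]/(h^-1 * _).
  by rewrite mulrBl mulrAC mulVf // mul1r [h + z]addrC.
split=> [H|[dv <-] e e0].
  have cq : q h @[h --> 0^'] --> c.
    apply/cvgrPdist_le => e e0; have [d d0 dP] := H e e0.
    near=> h.
    have h0 : h != 0 by near: h; exact: nbhs_dnbhs_neq.
    rewrite -(@ler_pM2r _ `|h|) ?normr_gt0 // qE //.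
    by apply: dP; near: h; exact: dnbhs0_lt.
  split; first by apply/cvg_ex; exists c.
  by apply: cvg_lim.
have /cvgrPdist_le/(_ e e0) := dv.
rewrite -[lim _]/('D_1 f z) => /nbhs_ballP[d /= d0 dP].
exists d => // h hd; have [->|h0] := eqVneq h 0.
  by rewrite addr0 subrr mulr0 subrr !normr0 mulr0.
have := dP h; rewrite /ball /= sub0r normrN => /(_ hd h0).
rewrite -(@ler_pM2r _ `|h|) ?normr_gt0 // => qh.
by rewrite -qE.
Unshelve. all: by end_near.
Qed.

Lemma has_deriv_cst a z : has_deriv (fun=> a) z 0.
Proof. by apply/has_derivP; exact: is_derive_cst. Qed.

Lemma has_deriv_id z : has_deriv id z 1.
Proof. by apply/has_derivP; exact: is_derive_id. Qed.

Lemma has_derivD f g z c c' : has_deriv f z c -> has_deriv g z c' ->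
  has_deriv (fun x => f x + g x) z (c + c').
Proof.
by move=> /has_derivP ? /has_derivP ?; apply/has_derivP; exact: is_deriveD.
Qed.

Lemma has_derivM f g z c c' : has_deriv f z c -> has_deriv g z c' ->
  has_deriv (fun x => f x * g x) z (c * g z + f z * c').
Proof.
move=> /has_derivP ? /has_derivP ?; apply/has_derivP.
apply: is_derive_eq; rewrite -[_ *: c]/(_ * c) -[_ *: c']/(_ * c').
by rewrite addrC [g z * _]mulrC.
Qed.

Lemma has_derivV f z c : has_deriv f z c -> f z != 0 ->
  has_deriv (fun x => (f x)^-1) z (- c / f z ^+ 2).
Proof.
move=> /has_derivP[df <-] fz0; apply/has_derivP; split; first exact: derivableV.
by rewrite deriveV // -[_ *: _]/(_ * _) mulrC mulrN mulNr.
Qed.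

Lemma has_deriv_comp f g z c c' : has_deriv f z c -> has_deriv g (f z) c' ->
  has_deriv (fun x => g (f x)) z (c' * c).
Proof.
move=> /has_derivP[df df1] /has_derivP[dg dg1]; apply/has_derivP.
move/derivable1_diffP: df (df) => df df'.
move/derivable1_diffP: dg (dg) => dg dg'.
have gf : differentiable (g \o f) z by exact: differentiable_comp.
split; first exact/derivable1_diffP.
rewrite deriveE // diff_comp //= diff1E // diff1E // !derive1E.
by rewrite df1 dg1 -![_ *: _]/(_ * _) mul1r mulrC.
Qed.

End PointwiseDerivative.

(** * The Hermitian space *)

Section Hermitian.
Variables (C : numClosedFieldType) (d : nat).
Implicit Types (u v w z : 'cV[C]_d) (A : 'M[C]_d).

Definition hdot u v : C := (v ^t* *m u) 0 0.
Definition hsq u : C := \sum_(i < d) `|u i 0| ^+ 2.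

Lemma hdotE u v : hdot u v = \sum_i (v i 0)^* * u i 0.
Proof. by rewrite /hdot mxE; apply: eq_bigr => i _; rewrite !mxE. Qed.

Lemma hdot_hsq u : hdot u u = hsq u.
Proof. by rewrite hdotE; apply: eq_bigr => i _; rewrite normCKC. Qed.

Lemma hdotDl u v w : hdot (u + v) w = hdot u w + hdot v w.
Proof. by rewrite /hdot mulmxDr mxE. Qed.

Lemma hdotZl c u w : hdot (c *: u) w = c * hdot u w.
Proof. by rewrite /hdot -scalemxAr mxE. Qed.

Lemma hdotC u v : hdot u v = (hdot v u)^*.
Proof.
rewrite !hdotE rmorph_sum; apply: eq_bigr => i _.
by rewrite rmorphM /= conjCK mulrC.
Qed.

Lemma hdotDr u v w : hdot u (v + w) = hdot u v + hdot u w.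
Proof. by rewrite hdotC hdotDl rmorphD /= -!hdotC. Qed.

Lemma hdotZr c u w : hdot u (c *: w) = c^* * hdot u w.
Proof. by rewrite hdotC hdotZl rmorphM /= -hdotC. Qed.

Lemma hsq_ge0 u : 0 <= hsq u.
Proof. by apply: sumr_ge0 => i _; rewrite exprn_ge0. Qed.

Lemma hsqZ c u : hsq (c *: u) = `|c| ^+ 2 * hsq u.
Proof. by rewrite -!hdot_hsq hdotZl hdotZr mulrA -normCK. Qed.

Lemma hsq0 : hsq 0 = 0.
Proof. by rewrite -(scale0r 0) hsqZ normr0 expr0n mul0r. Qed.

Lemma hsq_eq0 u : hsq u = 0 -> u = 0.
Proof.
move=> /eqP; rewrite psumr_eq0 => [/allP H|i _]; last by rewrite exprn_ge0.
apply/colP => i; rewrite mxE; apply/eqP.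
by have := H i (mem_index_enum i); rewrite expf_eq0 normr_eq0.
Qed.

(** Both the Cauchy-Schwarz inequality and its equality case (u is a multiple
    of v) can be read off this formula. *)
Lemma hsq_orthogonal_part u v : hsq v = 1 ->
  hsq (u - hdot u v *: v) = hsq u - `|hdot u v| ^+ 2.
Proof.
move=> v1; rewrite -scaleNr -[LHS]hdot_hsq hdotDl !hdotDr !hdotZl !hdotZr.
rewrite !hdot_hsq v1 mulr1 [hdot v u]hdotC rmorphN /= normCK; ring.
Qed.

Lemma hdot_le u v : hsq v = 1 -> `|hdot u v| ^+ 2 <= hsq u.
Proof. by move=> v1; rewrite -subr_ge0 -hsq_orthogonal_part // hsq_ge0. Qed.

(** Lets a map that preserves [hsq] be recognized as preserving [hdot]. *)
Lemma hsq_polarization u v :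
  hdot u v *+ 2 = (hsq (u + v) - hsq u - hsq v)
                  - 'i * (hsq ('i *: u + v) - hsq ('i *: u) - hsq v).
Proof.
rewrite -!hdot_hsq !hdotDl !hdotDr !hdotZl !hdotZr conjCi.
have := sqrCi C; rewrite expr2 => i2.
ring: i2.
Qed.

Lemma hsq_preserving_unitary A : (forall z, hsq (A *m z) = hsq z) ->
  A \is unitarymx.
Proof.
move=> HA; rewrite -trmxC_unitary; apply/unitarymxP; rewrite trmxCK.
have AA u v : hdot (A *m u) (A *m v) = hdot u v.
  apply: (@mulIf C 2%:R); first by rewrite pnatr_eq0.
  rewrite !mulr_natr !hsq_polarization.
  by rewrite scalemxAr -!mulmxDr !HA.
have cA (M : 'M[C]_d) j k : (M *m delta_mx j (0 : 'I_1)) k 0 = M k j.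
  rewrite mxE (bigD1 j) //= mxE !eqxx mulr1 big1 ?addr0 // => l /negPf lj.
  by rewrite mxE lj mulr0.
apply/matrixP => i j.
have dd : hdot (delta_mx j 0) (delta_mx i 0) = (i == j)%:R :> C.
  rewrite hdotE (bigD1 i) //= big1 => [|l /negPf li].
    by rewrite !mxE !eqxx conjC1 mul1r addr0 andbT.
  by rewrite !mxE li conjC0 mul0r.
rewrite !mxE -dd -AA hdotE; apply: eq_bigr => k _.
by rewrite !cA !mxE.
Qed.

Lemma unitary_hsq A z : A \is unitarymx -> hsq (A *m z) = hsq z.
Proof.
move=> Au; rewrite -!hdot_hsq /hdot trmx_mul map_mxM mulmxA.
by rewrite -{2}[A]trmxCK mulmxtVK // trmxC_unitary.
Qed.

End Hermitian.

(** * Holomorphic maps between Hermitian spaces *)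

Section Differentiability.
Variables (C : numClosedFieldType) (d : nat).
Implicit Types (u v w z : 'cV[C]_d) (A : 'M[C]_d) (F : 'cV[C]_d -> 'cV[C]_d).

Lemma differentiable_deriv (f : C -> C) (z : C) : differentiable f z ->
  exists c, has_deriv f z c.
Proof.
move=> /derivable1_diffP df; exists ('D_1 f z).
exact/has_derivP/derivableP.
Qed.

Lemma differentiable_sum_fun (V : normedModType C) (W : normedModType C) n
    (f : 'I_n -> V -> W) x :
  (forall i, differentiable (f i) x) ->
  differentiable (fun y => \sum_(i < n) f i y) x.
Proof.
move=> df; have -> : (fun y => \sum_(i < n) f i y) = \sum_(i < n) f i.
  by apply/funext => y; rewrite fct_sumE.
exact: differentiable_sum.
Qed.

Lemma differentiable_line F u (x : C) : differentiable F (x *: u) ->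
  differentiable (fun y : C => F (y *: u)) x.
Proof.
move=> dF; have dl : differentiable (fun y : C => y *: u) x by [].
exact: differentiable_comp dl dF.
Qed.

Lemma slice_deriv F u w (x : C) : differentiable F (x *: u) ->
  exists c, has_deriv (fun y => hdot (F (y *: u)) w) x c.
Proof.
move=> dF; apply: differentiable_deriv.
have -> : (fun y => hdot (F (y *: u)) w) =
    (fun y => \sum_(i < d) (w i 0)^* *: F (y *: u) i 0).
  by apply/funext => y; rewrite hdotE.
apply: differentiable_sum_fun => i.
apply: differentiableZ.
exact: differentiable_comp (differentiable_line dF)
  (differentiable_coord _ _ _).
Qed.

Lemma differentiable_col F x :
  (forall i, differentiable (fun z => F z i 0) x) -> differentiable F x.
Proof.
move=> dF; have -> : F = fun z => \sum_(i < d) F z i 0 *: delta_mx i 0.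
  apply/funext => z; apply/colP => j; rewrite summxE (bigD1 j) //= !mxE !eqxx.
  by rewrite mulr1 big1 ?addr0 // => i /negPf ij; rewrite !mxE eq_sym ij mulr0.
by apply: differentiable_sum_fun => i; exact: differentiableZl.
Qed.

Lemma differentiable_mulmx A x : differentiable (fun z => A *m z) x.
Proof.
apply: differentiable_col => i.
have -> : (fun z => (A *m z) i 0) = fun z => \sum_j A i j *: z j 0.
  by apply/funext => z; rewrite mxE.
apply: differentiable_sum_fun => j.
by apply: differentiableZ; exact: differentiable_coord.
Qed.

(** The matrix of the differential at 0, known through the directional
    derivatives of the coordinates only, which are one-variable statements. *)
Lemma differential_matrix F : differentiable F 0 ->
  exists A, forall z i, has_deriv (fun y => F (y *: z) i 0) 0 ((A *m z) i 0).
Proof.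
move=> dF; pose L : {linear 'cV[C]_d -> 'cV[C]_d} := 'd F 0.
exists (\matrix_(i, j) L (delta_mx j 0) i 0) => z i.
have -> : ((\matrix_(i, j) L (delta_mx j 0) i 0) *m z) i 0 = L z i 0.
  have zE : z = \sum_j z j 0 *: delta_mx j 0.
    apply/colP => k; rewrite summxE (bigD1 k) //= !mxE !eqxx.
    rewrite mulr1 big1 ?addr0 // => l /negPf ij.
    by rewrite !mxE eq_sym ij mulr0.
  rewrite [in RHS]zE linear_sum summxE mxE; apply: eq_bigr => j _.
  by rewrite linearZ !mxE mulrC.
apply/has_derivP.
have H : (fun h => h^-1 *: ((F \o shift 0) (h *: z) - F 0)) @ 0^' --> L z.
  by rewrite /L -deriveE //; exact: diff_derivable.
have Hi : (fun h => h^-1 *: ((fun y => F (y *: z) i 0) (h *: 1 + 0)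
    - F (0 *: z) i 0)) @ 0^' --> L z i 0.
  have := cvg_comp _ _ H (@coord_continuous _ _ _ i 0 (L z)).
  apply: cvg_trans; apply: near_eq_cvg; apply: nearW => h.
  by rewrite /= !mxE scale0r !addr0 -[h *: 1]/(h * 1) mulr1.
split; first by apply/cvg_ex; exists (L z i 0).
by apply: cvg_lim.
Qed.

(** Stated over an abstract field, so that it can be used at R[i] without
    inferring a topology there. *)
Definition holomorphic_on_ball F := forall z, hsq z < 1 -> differentiable F z.

Lemma holomorphic_slice F u w (x : C) : holomorphic_on_ball F ->
  hsq (x *: u) < 1 -> exists c, has_deriv (fun y => hdot (F (y *: u)) w) x c.
Proof. by move=> dF /dF; exact: slice_deriv. Qed.

Lemma holomorphic_linearization F : holomorphic_on_ball F ->
  exists A, forall z i, has_deriv (fun y => F (y *: z) i 0) 0 ((A *m z) i 0).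
Proof. by move=> dF; apply/differential_matrix/dF; rewrite hsq0 ltr01. Qed.

End Differentiability.

(** * Automorphisms of the ball *)

Section BallMaps.
Variables (C : numClosedFieldType) (d : nat).
Implicit Types (z : 'cV[C]_d) (A : 'M[C]_d) (F G : 'cV[C]_d -> 'cV[C]_d).
Implicit Types (f g h : ball_map C d).

Definition ball_map_of F (FB : forall z, hsq z < 1 -> hsq (F z) < 1)
  : ball_map C d :=
  fun p => SigSub (mem_set
    (FB (\val p) (set_valP p) : unit_ball C d (F (\val p)))).

Definition ball_point z (zB : hsq z < 1) : set_type (unit_ball C d) :=
  SigSub (mem_set (zB : unit_ball C d z)).

Lemma hsq_val (p : set_type (unit_ball C d)) : hsq (\val p) < 1.
Proof. exact: set_valP p. Qed.

Lemma eq_ball_map f g : (forall p, \val (f p) = \val (g p)) -> f = g.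
Proof. by move=> fg; apply/funext => p; apply: val_inj. Qed.

Lemma ball_map_of_Aut F G (FB : forall z, hsq z < 1 -> hsq (F z) < 1)
    (GB : forall z, hsq z < 1 -> hsq (G z) < 1) :
  (forall z, hsq z < 1 -> differentiable F z) ->
  (forall z, hsq z < 1 -> differentiable G z) ->
  (forall z, hsq z < 1 -> G (F z) = z) ->
  (forall z, hsq z < 1 -> F (G z) = z) ->
  Aut_ball C d (@ball_map_of F FB).
Proof.
move=> dF dG FK GK; split; first by exists F.
exists (@ball_map_of G GB); split; first by exists G.
- by move=> z; apply: val_inj => /=; apply: FK; exact: hsq_val.
- by move=> z; apply: val_inj => /=; apply: GK; exact: hsq_val.
Qed.

Lemma holomorphic_comp f g : holomorphic_ball_map f -> holomorphic_ball_map g ->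
  holomorphic_ball_map (f \o g).
Proof.
move=> [F [Ff dF]] [G [Gg dG]]; exists (F \o G); split=> [z|z zB] /=.
  by rewrite Gg Ff.
apply: differentiable_comp; first exact: dG.
by apply: dF; rewrite (Gg (ball_point zB)); exact: hsq_val.
Qed.

Lemma Aut_comp f g : Aut_ball C d f -> Aut_ball C d g -> Aut_ball C d (f \o g).
Proof.
move=> [hf [f' [hf' fK f'K]]] [hg [g' [hg' gK g'K]]].
split; first exact: holomorphic_comp.
exists (g' \o f'); split; first exact: holomorphic_comp.
- exact: can_comp.
- exact: can_comp.
Qed.

Lemma unitary_ball A : A \is unitarymx ->
  forall z, hsq z < 1 -> hsq (A *m z) < 1.
Proof. by move=> Au z; rewrite unitary_hsq. Qed.

Definition unitary_map A (Au : A \is unitarymx) :=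
  ball_map_of (unitary_ball Au).

Lemma unitary_map_unitary A Au : unitary_ball_maps C d (@unitary_map A Au).
Proof. by exists A. Qed.

Lemma unitary_ball_mapP f : unitary_ball_maps C d f ->
  exists A (Au : A \is unitarymx), f = unitary_map Au.
Proof. by move=> [A Au fA]; exists A, Au; exact: eq_ball_map. Qed.

Lemma unitary_adjK A z : A \is unitarymx -> A ^t* *m (A *m z) = z.
Proof.
move=> Au; rewrite mulmxA -[X in _ *m X *m _]trmxCK (unitarymxP _) ?mul1mx //.
by rewrite trmxC_unitary.
Qed.

Lemma unitary_adjKV A z : A \is unitarymx -> A *m (A ^t* *m z) = z.
Proof. by move=> Au; rewrite mulmxA (unitarymxP _) ?mul1mx. Qed.

Lemma unitary_Aut : unitary_ball_maps C d `<=` Aut_ball C d.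
Proof.
move=> _ /unitary_ball_mapP[A [Au ->]].
have Ast : A ^t* \is unitarymx by rewrite trmxC_unitary.
apply: (@ball_map_of_Aut _ (fun z => A ^t* *m z) _ (unitary_ball Ast)) => z _.
- exact: differentiable_mulmx.
- exact: differentiable_mulmx.
- exact: unitary_adjK.
- exact: unitary_adjKV.
Qed.

Lemma unitary_comp f g : unitary_ball_maps C d f -> unitary_ball_maps C d g ->
  unitary_ball_maps C d (f \o g).
Proof.
move=> [A Au fA] [B Bu gB]; exists (A *m B); first exact: mul_unitarymx.
by move=> z /=; rewrite fA gB mulmxA.
Qed.

Lemma unitary_inverse f : unitary_ball_maps C d f ->
  exists g, [/\ unitary_ball_maps C d g, cancel f g & cancel g f].
Proof.
move=> /unitary_ball_mapP[A [Au ->]].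
have Ast : A ^t* \is unitarymx by rewrite trmxC_unitary.
exists (unitary_map Ast); split; first exact: unitary_map_unitary.
- by move=> z; apply: val_inj; exact: unitary_adjK.
- by move=> z; apply: val_inj; exact: unitary_adjKV.
Qed.

Section Moebius.
Variable i0 : 'I_d.

(** For real t, the ball automorphism that moves 0 to t e_i0; on the
    axis of e_i0 it is the disk automorphism z |-> (z + t) / (1 + t z). *)
Definition ball_moebius (t : C) z : 'cV[C]_d :=
  \col_i ((if i == i0 then z i0 0 + t else sqrtC (1 - t ^+ 2) * z i 0)
          / (1 + t * z i0 0)).

Lemma coord_lt1 z i : hsq z < 1 -> `|z i 0| < 1.
Proof.
move=> z1; rewrite -(@expr_lt1 _ 2) //; apply: le_lt_trans z1.
by rewrite /hsq (bigD1 i) //= lerDl sumr_ge0 // => j _; rewrite exprn_ge0.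
Qed.

Variable t : C.
Hypotheses (t_real : t \is Num.real) (t1 : `|t| < 1).

Lemma ball_moebius_den z : hsq z < 1 -> 1 + t * z i0 0 != 0.
Proof.
move=> /(coord_lt1 i0) z1; rewrite addrC addr_eq0; apply: contraTneq (t1) => tz.
have : `|t * z i0 0| = 1 by rewrite tz normrN1.
rewrite normrM => tz1; apply/negP => _.
have : `|t| * `|z i0 0| < 1 by rewrite mulr_ilt1.
by rewrite tz1 ltxx.
Qed.

Lemma one_sub_sqr_gt0 : 0 < 1 - t ^+ 2.
Proof. by rewrite subr_gt0 -real_normK // expr_lt1. Qed.

(** This identity shows at once that the ball is preserved and how far a
    point is moved from the centre. *)
Lemma ball_moebius_hsq z : hsq z < 1 ->
  1 - hsq (ball_moebius t z) =
  (1 - t ^+ 2) * (1 - hsq z) / `|1 + t * z i0 0| ^+ 2.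
Proof.
move=> z1; have den := ball_moebius_den z1.
have n0 : `|1 + t * z i0 0| ^+ 2 != 0 by rewrite expf_neq0 // normr_eq0.
apply: (mulIf n0); rewrite mulfVK // mulrBl mul1r.
have -> : hsq (ball_moebius t z) * `|1 + t * z i0 0| ^+ 2 =
    `|z i0 0 + t| ^+ 2 + (1 - t ^+ 2) * (hsq z - `|z i0 0| ^+ 2).
  rewrite /hsq mulr_suml (bigD1 i0) //= [in RHS](bigD1 i0) //=.
  rewrite [X in _ * (X - _)]addrC addrK mulr_sumr; congr (_ + _).
    by rewrite mxE eqxx normf_div expr_div_n mulfVK.
  apply: eq_bigr => i /negPf ii; rewrite mxE ii normf_div expr_div_n mulfVK //.
  rewrite normrM exprMn ger0_norm ?sqrtCK // sqrtC_ge0 ltW //.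
  exact: one_sub_sqr_gt0.
have tc : t^* = t by exact/CrealP.
rewrite !normCK !rmorphD rmorphM /= rmorph1 tc; ring.
Qed.

Lemma ball_moebius_ball z : hsq z < 1 -> hsq (ball_moebius t z) < 1.
Proof.
move=> z1; rewrite -subr_gt0 ball_moebius_hsq //.
rewrite divr_gt0 ?exprn_gt0 ?normr_gt0 ?ball_moebius_den //.
by rewrite mulr_gt0 ?one_sub_sqr_gt0 ?subr_gt0.
Qed.

Lemma ball_moebius_differentiable z : hsq z < 1 ->
  differentiable (ball_moebius t) z.
Proof.
move=> z1; apply: differentiable_col => i.
pose num (y : 'cV[C]_d) :=
  if i == i0 then y i0 0 + t else sqrtC (1 - t ^+ 2) *: y i 0.
have -> : (fun y => ball_moebius t y i 0) =
    (fun y => num y * (1 + t *: y i0 0)^-1).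
  by apply/funext => y; rewrite mxE /num; case: ifP.
apply: differentiableM.
  rewrite /num; case: (i == i0).
    by apply: differentiableD => //; exact: differentiable_coord.
  by apply: differentiableZ; exact: differentiable_coord.
apply: differentiableV; last exact: ball_moebius_den.
apply: differentiableD => //.
by apply: differentiableZ; exact: differentiable_coord.
Qed.

Lemma ball_moebiusK z : hsq z < 1 -> ball_moebius (- t) (ball_moebius t z) = z.
Proof.
move=> z1; have den := ball_moebius_den z1.
have s0 : 1 - t ^+ 2 != 0 by rewrite gt_eqF // one_sub_sqr_gt0.
apply/colP => i; rewrite !mxE eqxx.
have D : 1 + - t * ((z i0 0 + t) / (1 + t * z i0 0)) =
    (1 - t ^+ 2) / (1 + t * z i0 0).
  by field.
rewrite D sqrrN; case: eqP => [->|_].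
  by field; rewrite den.
rewrite mulrA [_ * (_ * z i 0)]mulrA -expr2 sqrtCK; field.
by rewrite den.
Qed.

End Moebius.

Lemma moebius_Aut i0 t (t_real : t \is Num.real) (t1 : `|t| < 1) :
  Aut_ball C d (ball_map_of (@ball_moebius_ball i0 t t_real t1)).
Proof.
have tNr : - t \is Num.real by rewrite realN.
have tN1 : `|- t| < 1 by rewrite normrN.
apply: (@ball_map_of_Aut _ _ _ (@ball_moebius_ball i0 (- t) tNr tN1)) => z.
- exact: ball_moebius_differentiable.
- exact: ball_moebius_differentiable.
- exact: ball_moebiusK.
- by move=> z1; have := ball_moebiusK i0 tNr tN1 z1; rewrite opprK.
Qed.

(** Gram-Schmidt orthonormalization, started from the transpose of z, produces
    a unitary matrix whose row of index 0 is proportional to that transpose; its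
    conjugate maps z to the axis.  As [schmidt_subproof] controls one row only
    relative to those above it, the axis has to be the one of index 0. *)
Lemma unitary_to_axis (i0 : 'I_d) z : i0 = 0%N :> nat ->
  exists A c, [/\ A \is unitarymx, 0 <= c & A *m z = c *: delta_mx i0 0].
Proof.
move=> i00; have [B Bu /forallP/(_ i0)] := @schmidt_subproof C d d
  (\matrix_(i, j) z j 0) (leqnn d).
rewrite (big_pred1 i0) => [|k]; last first.
  by rewrite i00 leqn0 -i00.
rewrite genmxE => /andP[/sub_rVP[c rowz]]; rewrite rowz.
have BB i : (B *m B ^t*) i0 i = (i == i0)%:R.
  by rewrite (unitarymxP Bu) mxE eq_sym.
have zB j : z j 0 = c * B i0 j by have /rowP/(_ j) := rowz; rewrite !mxE.
move=> c0; exists (B ^ Num.Def.conjC), c; split; first by rewrite conjC_unitary.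
  move: c0; rewrite dotmxE mxE; congr (0 <= _).
  transitivity (c * (B *m B ^t*) i0 i0); last by rewrite BB eqxx mulr1.
  by rewrite mxE mulr_sumr; apply: eq_bigr => j _; rewrite !mxE mulrA.
apply/colP => i; rewrite !mxE andbT -BB !mxE mulr_sumr; apply: eq_bigr => j _.
by rewrite !mxE zB mulrCA [_ * B i0 j]mulrC.
Qed.

End BallMaps.

Local Open Scope complex_scope.
Local Notation Re := complex.Re.
Local Notation Im := complex.Im.

(** * Integrals of continuous functions over segments *)

Section Integral.
Variable R : realType.
Implicit Types (f g : R -> R) (a b c : R).

Definition int_on a b f : R := \int[lebesgue_measure]_(x in `[a, b]) f x.

Lemma continuous_integrable f a b : {in `[a, b], continuous f} ->
  lebesgue_measure.-integrable `[a, b] (EFin \o f).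
Proof.
move=> cf; apply: continuous_compact_integrable.
  by apply: segment_compact.
by apply: continuous_in_subspaceT => x /set_mem; exact: cf.
Qed.

Lemma int_on_cat f a b c : a <= b -> b <= c -> {in `[a, c], continuous f} ->
  int_on a c f = int_on a b f + int_on b c f.
Proof.
move=> ab bc cf; have fi := continuous_integrable cf.
have /= H := @Rintegral_itvB R f (BLeft a) (BRight c) b fi.
rewrite /int_on -(@Rintegral_itv_obnd_cbnd R b (BRight c) f) -?H ?bnd_simp //.
  by rewrite addrC subrK.
apply: integrableS fi => //.
by apply: subset_itv; rewrite bnd_simp.
Qed.

(** The comparison with a constant is the only estimate of integrals that is
    needed: opposite sides of a small rectangle carry functions whose
    difference is almost constant. *)
Lemma int_onB_near_const f g a b c M : a <= b ->
  {in `[a, b], continuous f} -> {in `[a, b], continuous g} ->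
  (forall t, a <= t <= b -> `|f t - g t - c| <= M) ->
  `|int_on a b f - int_on a b g - c * (b - a)| <= M * (b - a).
Proof.
move=> ab cf cg fgM.
have fi := continuous_integrable cf; have gi := continuous_integrable cg.
have constE k : \int[lebesgue_measure]_(x in `[a, b]) k = k * (b - a) :> R.
  by rewrite Rintegral_cst //= lebesgue_measure_itv /= lte_fin;
     case: ltgtP ab => //= -> _; rewrite subrr.
have ci k : lebesgue_measure.-integrable `[a, b] (EFin \o (fun=> k : R)).
  by apply: continuous_integrable => x _; exact: cst_continuous.
rewrite /int_on -RintegralB // -(constE c) -RintegralB //; last first.
  apply: continuous_integrable => x xab.
  by apply: cvgB; [exact: cf | exact: cg].
rewrite -(constE M); set F := fun x => f x - g x - c.
have Fi : lebesgue_measure.-integrable `[a, b] (EFin \o F).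
  apply: continuous_integrable => x xab; apply: cvgB; last exact: cvg_cst.
  by apply: cvgB; [exact: cf | exact: cg].
rewrite ler_norml; apply/andP; split.
  rewrite constE -mulNr -constE; apply: le_Rintegral => // x /=.
  by rewrite in_itv /= => /fgM; rewrite ler_norml => /andP[].
apply: le_Rintegral => // x /=.
by rewrite in_itv /= => /fgM; rewrite ler_norml => /andP[].
Qed.

End Integral.

Section Goursat.
Variable R : realType.
Variables u v : R -> R -> R.

(** Differentiability of u + i v at x + i y as a function of a complex
    variable, the derivative being a + i b. *)
Definition cauchy_riemann x y := exists a b : R, forall e, 0 < e ->
  exists2 d, 0 < d & forall h k, `|h| < d -> `|k| < d ->
    `|u (x + h) (y + k) - u x y - (a * h - b * k)| <= e * (`|h| + `|k|) /\
    `|v (x + h) (y + k) - v x y - (b * h + a * k)| <= e * (`|h| + `|k|).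

(** The integral of v dx + u dy along the boundary of the rectangle
    [x, x + w] x [y, y + l], that is, the imaginary part of the integral of
    (u + i v) dz. *)
Definition boundary_int x y w l : R :=
  (int_on y (y + l) (u (x + w)) - int_on y (y + l) (u x)) +
  (int_on x (x + w) (v ^~ y) - int_on x (x + w) (v ^~ (y + l))).

Lemma lipschitz_at_continuous (f : R -> R) x :
  (exists K d : R, [/\ 0 <= K, 0 < d &
    forall h, `|h| < d -> `|f (x + h) - f x| <= K * `|h|]) ->
  {for x, continuous f}.
Proof.
move=> [K [d [K0 d0 fK]]]; apply/cvgrPdist_le => e e0 /=.
have K1 : 0 < K + 1 by rewrite ltr_wpDl.
apply/nbhs_normP; exists (Num.min d (e / (K + 1))) => [|t /=].
  by rewrite /= lt_min d0 divr_gt0.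
rewrite distrC lt_min => /andP[td te].
have -> : t = x + (t - x) by rewrite addrC subrK.
rewrite distrC; apply: le_trans (fK _ td) _.
apply: (@le_trans _ _ ((K + 1) * `|t - x|)).
  by rewrite ler_wpM2r // lerDl.
by rewrite mulrC -ler_pdivlMr // ltW.
Qed.

Lemma cauchy_riemann_continuous x y : cauchy_riemann x y ->
  [/\ {for x, continuous (u ^~ y)}, {for y, continuous (u x)},
      {for x, continuous (v ^~ y)} & {for y, continuous (v x)}].
Proof.
move=> [a [b /(_ 1 ltr01)[d d0 H]]].
have aux (p h A B : R) : `|A - B| <= 1 * `|h| -> B = p * h ->
    `|A| <= (1 + `|p|) * `|h|.
  move=> + BE; rewrite BE mul1r => Ah.
  rewrite mulrDl mul1r -normrM -[A in leLHS](subrK (p * h)).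
  by rewrite (le_trans (ler_normD _ _)) // lerD2r.
have h0 : `|0 : R| < d by rewrite normr0.
split; apply: lipschitz_at_continuous.
- exists (1 + `|a|), d; split=> // h hd; have [+ _] := H h 0 hd h0.
  by rewrite addr0 normr0 addr0 => /aux; apply; ring.
- exists (1 + `|- b|), d; split=> // h hd; have [+ _] := H 0 h h0 hd.
  by rewrite addr0 normr0 add0r => /aux; apply; ring.
- exists (1 + `|b|), d; split=> // h hd; have [_] := H h 0 hd h0.
  by rewrite addr0 normr0 addr0 => /aux; apply; ring.
- exists (1 + `|a|), d; split=> // h hd; have [_] := H 0 h h0 hd.
  by rewrite addr0 normr0 add0r => /aux; apply; ring.
Qed.

Definition cauchy_riemann_on x y w l := forall s t,
  x <= s <= x + w -> y <= t <= y + l -> cauchy_riemann s t.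

Lemma cauchy_riemann_onS x y w l x' y' w' l' : cauchy_riemann_on x y w l ->
  x <= x' -> x' + w' <= x + w -> y <= y' -> y' + l' <= y + l ->
  cauchy_riemann_on x' y' w' l'.
Proof.
by move=> H ? ? ? ? s t /andP[? ?] /andP[? ?]; apply: H; apply/andP; split; lra.
Qed.

Lemma cauchy_riemann_on_continuous x y w l : cauchy_riemann_on x y w l ->
  (forall t, y <= t <= y + l -> {in `[x, x + w], continuous (v ^~ t)}) /\
  (forall s, x <= s <= x + w -> {in `[y, y + l], continuous (u s)}).
Proof.
move=> H; split.
- move=> t yt s; rewrite in_itv => /= sx.
  by have [] := cauchy_riemann_continuous (H _ _ sx yt).
- move=> s xs t; rewrite in_itv => /= ty.
  by have [] := cauchy_riemann_continuous (H _ _ xs ty).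
Qed.

Lemma boundary_int_split4 x y w l : 0 <= w -> 0 <= l ->
  cauchy_riemann_on x y w l ->
  boundary_int x y w l =
    boundary_int x y (w / 2) (l / 2) +
    boundary_int (x + w / 2) y (w / 2) (l / 2) +
    boundary_int x (y + l / 2) (w / 2) (l / 2) +
    boundary_int (x + w / 2) (y + l / 2) (w / 2) (l / 2).
Proof.
move=> w0 l0 /cauchy_riemann_on_continuous[cv cu].
have xw : x + w / 2 + w / 2 = x + w by lra.
have yl : y + l / 2 + l / 2 = y + l by lra.
rewrite /boundary_int xw yl.
have U s : x <= s <= x + w ->
  int_on y (y + l) (u s) =
  int_on y (y + l / 2) (u s) + int_on (y + l / 2) (y + l) (u s).
  by move=> xs; apply: int_on_cat; [lra| lra| exact: cu].
have V t : y <= t <= y + l ->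
  int_on x (x + w) (v ^~ t) =
  int_on x (x + w / 2) (v ^~ t) + int_on (x + w / 2) (x + w) (v ^~ t).
  by move=> yt; apply: int_on_cat; [lra| lra| exact: cv].
rewrite !U ?V; try (apply/andP; split; lra).
by lra.
Qed.

(** If u + i v is close to an affine holomorphic function, the boundary
    integral is small: on opposite sides the affine function differs by the
    constants a w and - a l, whose contributions a w l and - a l w cancel. *)
Lemma boundary_int_small x y w l s t a b e : 0 <= w -> 0 <= l ->
  cauchy_riemann_on x y w l ->
  x <= s <= x + w -> y <= t <= y + l ->
  (forall x' y', x <= x' <= x + w -> y <= y' <= y + l ->
    `|u x' y' - u s t - (a * (x' - s) - b * (y' - t))| <= e /\
    `|v x' y' - v s t - (b * (x' - s) + a * (y' - t))| <= e) ->
  `|boundary_int x y w l| <= (2 * e) * (w + l).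
Proof.
move=> w0 l0 /cauchy_riemann_on_continuous[cv cu] xs yt H.
have -> : (2 * e) * (w + l) =
  (2 * e) * ((y + l) - y) + (2 * e) * ((x + w) - x) by ring.
have -> : boundary_int x y w l =
  (int_on y (y + l) (u (x + w)) - int_on y (y + l) (u x)
     - (a * w) * ((y + l) - y)) +
  (int_on x (x + w) (v ^~ y) - int_on x (x + w) (v ^~ (y + l))
     - (- (a * l)) * ((x + w) - x)).
  by rewrite /boundary_int; ring.
have xl : x <= x <= x + w by lra.
have xr : x <= x + w <= x + w by lra.
have yl : y <= y <= y + l by lra.
have yr : y <= y + l <= y + l by lra.
apply: le_trans (ler_normD _ _) _; apply: lerD.
- apply: int_onB_near_const; [lra| exact: cu| exact: cu|] => y' yy'.
  have [+ _] := H _ _ xl yy'; have [+ _] := H _ _ xr yy'.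
  by rewrite !ler_norml => /andP[? ?] /andP[? ?]; apply/andP; split; lra.
- apply: int_onB_near_const; [lra| exact: cv| exact: cv|] => x' xx'.
  have [_] := H _ _ xx' yl; have [_] := H _ _ xx' yr.
  by rewrite !ler_norml => /andP[? ?] /andP[? ?]; apply/andP; split; lra.
Qed.

End Goursat.

Section Goursat2.
Variable R : realType.
Variables u v : R -> R -> R.

Lemma boundary_int_quarter x y w l : 0 <= w -> 0 <= l ->
  cauchy_riemann_on u v x y w l ->
  exists p : R * R, [/\ x <= p.1 <= x + w / 2, y <= p.2 <= y + l / 2 &
    `|boundary_int u v x y w l| <=
      4 * `|boundary_int u v p.1 p.2 (w / 2) (l / 2)|].
Proof.
move=> w0 l0 H; rewrite (boundary_int_split4 w0 l0 H).
set A := boundary_int _ _ x y _ _; set B := boundary_int _ _ _ y _ _.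
set C := boundary_int _ _ x _ _ _; set D := boundary_int _ _ _ _ _ _.
have tri : `|A + B + C + D| <= `|A| + `|B| + `|C| + `|D|.
  by do 2!apply: le_trans (ler_normD _ _) (lerD _ _) => //; exact: ler_normD.
have X1 : x <= x <= x + w / 2 by lra.
have X2 : x <= x + w / 2 <= x + w / 2 by lra.
have Y1 : y <= y <= y + l / 2 by lra.
have Y2 : y <= y + l / 2 <= y + l / 2 by lra.
have [hA|hA] := leP `|A + B + C + D| (4 * `|A|); first by exists (x, y).
have [hB|hB] := leP `|A + B + C + D| (4 * `|B|); first by exists (x + w / 2, y).
have [hC|hC] := leP `|A + B + C + D| (4 * `|C|); first by exists (x, y + l / 2).
exists (x + w / 2, y + l / 2); split=> //=; rewrite -/D.
by lra.
Qed.

(** Intervals obtained by repeatedly keeping a half of the previous one have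
    a common point: the supremum of their left ends. *)
Lemma nested_intervals (s : nat -> R) (w : R) : 0 <= w ->
  (forall n, s n <= s n.+1 <= s n + w / 2 ^+ n.+1) ->
  exists c, forall n, s n <= c <= s n + w / 2 ^+ n.
Proof.
move=> w0 H.
have sS n : s n <= s n.+1 by have /andP[] := H n.
have mono : {homo s : m n / (m <= n)%N >-> m <= n}.
  by apply: homo_leq => //; exact: le_trans.
have right_mono m k : s (m + k)%N + w / 2 ^+ (m + k) <= s m + w / 2 ^+ m.
  elim: k => [|k IHk]; first by rewrite addn0.
  apply: le_trans IHk; rewrite addnS; have /andP[_ h] := H (m + k)%N.
  have : w / 2 ^+ (m + k) = w / 2 ^+ (m + k).+1 + w / 2 ^+ (m + k).+1.
    by rewrite exprS; field; rewrite expf_neq0.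
  by lra.
have ub m n : s m <= s n + w / 2 ^+ n.
  have [mn|nm] := leqP m n.
    by apply: le_trans (mono _ _ mn) _; rewrite lerDl divr_ge0 // exprn_ge0.
  have := right_mono n (m - n)%N; rewrite subnKC ?(ltnW nm) //.
  by apply: le_trans; rewrite lerDl divr_ge0 // exprn_ge0.
exists (sup (range s)) => n; apply/andP; split.
  apply: ub_le_sup; last by exists n.
  by exists (s 0%N + w / 2 ^+ 0) => _ [m _ <-]; exact: ub.
by apply: ge_sup => [|_ [m _ <-]]; [exists (s n), n|exact: ub].
Qed.

(** Among the four quarters of a rectangle, one carries at least a quarter of
    the boundary integral.  Iterating gives rectangles that shrink to a point c,
    with boundary integrals at least 4^-n times the original one.
    Differentiability at c bounds them by e 4^-n, for every e > 0. *)
Theorem goursat x y w l : 0 < w -> 0 < l ->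
  cauchy_riemann_on u v x y w l -> boundary_int u v x y w l = 0.
Proof.
move=> w0 l0 H.
set ww := fun n => w / 2 ^+ n; set ll := fun n => l / 2 ^+ n.
have wwS n : ww n.+1 = ww n / 2 by rewrite /ww exprSr invfM mulrA.
have llS n : ll n.+1 = ll n / 2 by rewrite /ll exprSr invfM mulrA.
have ww0 n : 0 < ww n by rewrite divr_gt0 // exprn_gt0.
have ll0 n : 0 < ll n by rewrite divr_gt0 // exprn_gt0.
pose good n (p : R * R) := cauchy_riemann_on u v p.1 p.2 (ww n) (ll n).
pose nxt n (p q : R * R) := [/\ p.1 <= q.1 <= p.1 + ww n / 2,
  p.2 <= q.2 <= p.2 + ll n / 2 &
    `|boundary_int u v p.1 p.2 (ww n) (ll n)| <=
      4 * `|boundary_int u v q.1 q.2 (ww n / 2) (ll n / 2)|].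
have /choice[f fP] (np : nat * (R * R)) :
    exists q, good np.1 np.2 -> nxt np.1 np.2 q.
  have [g|ng] := pselect (good np.1 np.2); last by exists (0, 0).
  have [q qP] := boundary_int_quarter (ltW (ww0 _)) (ltW (ll0 _)) g.
  by exists q.
pose fix p n := if n is m.+1 then f (m, p m) else (x, y).
have gp n : good n (p n).
  elim: n => [|n IHn]; first by rewrite /good /ww /ll expr0 !divr1.
  have /= [h1 h2 _] := fP (n, p n) IHn.
  rewrite /good wwS llS; apply: cauchy_riemann_onS IHn _ _ _ _ => /=; lra.
have np n : nxt n (p n) (p n.+1) by exact: (fP (n, p n) (gp n)).
have big n : `|boundary_int u v x y w l| <=
    4 ^+ n * `|boundary_int u v (p n).1 (p n).2 (ww n) (ll n)|.
  elim: n => [|n IHn]; first by rewrite /= /ww /ll !expr0 !divr1 mul1r.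
  apply: le_trans IHn _; rewrite exprSr -mulrA ler_wpM2l ?exprn_ge0 //.
  by rewrite wwS llS; have [] := np n.
have [s sP] : exists c, forall n, (p n).1 <= c <= (p n).1 + ww n.
  apply: nested_intervals; first exact: ltW.
  by move=> n; rewrite -/(ww _) wwS; have [] := np n.
have [t tP] : exists c, forall n, (p n).2 <= c <= (p n).2 + ll n.
  apply: nested_intervals; first exact: ltW.
  by move=> n; rewrite -/(ll _) llS; have [] := np n.
have [a [b ab]] : cauchy_riemann u v s t.
  by apply: (gp 0%N); [exact: sP|exact: tP].
apply/eqP; rewrite -normr_le0; apply/ler_addgt0Pl => e e0; rewrite addr0.
(* The n-th rectangle has sides w / 2^n and l / 2^n, so an error of
   e' (w + l) / 2^n on the functions contributes at most
   2 e' (w + l)^2 / 4^n = e / 4^n. *)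
pose e' := e / (2 * (w + l) ^+ 2).
have wl0 : 0 < w + l by rewrite addr_gt0.
have e'0 : 0 < e' by rewrite divr_gt0 // mulr_gt0 // exprn_gt0.
have [d d0 dP] := ab e' e'0.
have [n nP] : exists n, ww n + ll n < d.
  have [n nP] : exists n : nat, (w + l) / d < n%:R.
    have := archi_boundP (ltW (divr_gt0 wl0 d0)).
    by exists (Num.bound ((w + l) / d)).
  exists n; rewrite /ww /ll -mulrDl ltr_pdivrMr ?exprn_gt0 //.
  rewrite mulrC -ltr_pdivrMr //; apply: lt_trans nP _.
  by rewrite -natrX ltr_nat ltn_expl.
apply: le_trans (big n) _.
have small : `|boundary_int u v (p n).1 (p n).2 (ww n) (ll n)| <=
   (2 * (e' * (ww n + ll n))) * (ww n + ll n).
  apply: (@boundary_int_small _ _ _ _ _ _ _ s t a b) => //; do ?exact: ltW.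
    exact: gp.
  move=> x' y' hx hy; have hs := sP n; have ht := tP n.
  have xs : `|x' - s| <= ww n by rewrite ler_norml; apply/andP; split; lra.
  have yt : `|y' - t| <= ll n by rewrite ler_norml; apply/andP; split; lra.
  have := ww0 n; have := ll0 n => lln wwn.
  have [] := dP (x' - s) (y' - t).
  - by apply: le_lt_trans xs _; lra.
  - by apply: le_lt_trans yt _; lra.
  rewrite !(addrC s, addrC t) !subrK => h1 h2.
  have le : e' * (`|x' - s| + `|y' - t|) <= e' * (ww n + ll n).
    by rewrite ler_pM2l // lerD.
  by split; [exact: le_trans h1 le|exact: le_trans h2 le].
apply: le_trans (ler_wpM2l _ small) _; first exact: exprn_ge0.
rewrite le_eqVlt; apply/orP; left; apply/eqP.
have -> : 4 ^+ n = (2 ^+ n) ^+ 2 :> R by rewrite exprAC; congr (_ ^+ n); ring.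
rewrite /e' /ww /ll; field.
by rewrite expf_neq0 //= gt_eqF.
Qed.

End Goursat2.

(** * The complex plane and its exponential *)

Section ComplexNorm.
Variable R : realType.
Implicit Types z w : R[i].

Lemma normcE z : `|z| = (normc z)%:C.
Proof. by []. Qed.

Lemma normc_real (x : R) : normc x%:C = `|x|.
Proof. by rewrite /= expr0n addr0 sqrtr_sqr. Qed.

Lemma normc_ge0 z : 0 <= normc z.
Proof. by case: z => a b; exact: sqrtr_ge0. Qed.

Lemma Re_le_normc z : `|Re z| <= normc z.
Proof.
by case: z => a b /=; rewrite -sqrtr_sqr ler_wsqrtr // lerDl sqr_ge0.
Qed.

Lemma Im_le_normc z : `|Im z| <= normc z.
Proof.
by case: z => a b /=; rewrite -sqrtr_sqr ler_wsqrtr // lerDr sqr_ge0.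
Qed.

Lemma normc_le_ReIm z : normc z <= `|Re z| + `|Im z|.
Proof.
case: z => a b /=; rewrite -[leRHS]ger0_norm ?addr_ge0 // -sqrtr_sqr.
rewrite ler_wsqrtr // sqrrD -[X in X + _ <= _]real_normK ?num_real //.
rewrite -[X in _ + X <= _]real_normK ?num_real // addrAC lerDl.
by rewrite mulrn_wge0 // mulr_ge0.
Qed.

Lemma normc_eq0 z : (normc z == 0) = (z == 0).
Proof. by apply/eqP/eqP => [/eq0_normc|->] //; exact: normc0. Qed.

Lemma has_deriv_normc (f : R[i] -> R[i]) z c : has_deriv f z c <->
  forall e : R, 0 < e -> exists2 d : R, 0 < d &
    forall h, normc h < d -> normc (f (z + h) - f z - c * h) <= e * normc h.
Proof.
split=> H e e0.
  have eC : 0 < e%:C :> R[i] by rewrite ltcR.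
  have [d d0 dP] := H _ eC; move: d0 (d0); rewrite {1}ltcE /= => /andP[_ d0] dC.
  exists (Re d) => // h hd.
  rewrite -lecR rmorphM /=; apply: dP.
  by rewrite -[d]RRe_real ?gtr0_real // ltcR.
move: e0 (e0); rewrite {1}ltcE /= => /andP[_ e0] eC.
have [d d0 dP] := H _ e0; exists d%:C; first by rewrite ltcR.
move=> h; rewrite normcE ltcR => /dP.
by rewrite -[e]RRe_real ?gtr0_real // !normcE -rmorphM lecR.
Qed.

End ComplexNorm.

Section ComplexExponential.
Variable R : realType.
Implicit Types z w : R[i].

Definition cexp z : R[i] :=
  (expR (Re z) * cos (Im z)) +i*
  (expR (Re z) * sin (Im z)).

Lemma cexpD z w : cexp (z + w) = cexp z * cexp w.
Proof.
case: z w => [a b] [c d]; rewrite /cexp /= expRD cosD sinD.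
by apply/eqP; rewrite eq_complex /=; apply/andP; split; apply/eqP; ring.
Qed.

Lemma cexp0 : cexp 0 = 1.
Proof. by rewrite /cexp /= expR0 cos0 sin0 mulr1 mulr0. Qed.

Lemma normc_cexp z : normc (cexp z) = expR (Re z).
Proof.
rewrite /= !exprMn -mulrDr cos2Dsin2 mulr1 sqrtr_sqr ger0_norm //.
Qed.

Lemma cexp_neq0 z : cexp z != 0.
Proof. by rewrite -normc_eq0 normc_cexp gt_eqF // expR_gt0. Qed.

Lemma cexp_period x : cexp (x +i* (pi *+ 2)) = cexp (x +i* 0).
Proof. by rewrite /cexp /= cos2pi sin2pi cos0 sin0. Qed.

(** With h = x + i y, the real and imaginary parts of exp h - 1 - h are
    (e^x - 1 - x) + e^x (cos y - 1) and e^x (sin y - y) + (e^x - 1) y. *)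
Lemma has_deriv_cexp0 : has_deriv cexp 0 1.
Proof.
apply/has_deriv_normc => e e0.
(* The bounds |e^x - 1| <= 2|x| <= 2 e' and e^x <= 3 lead to an error of at
   most e' |x| + 8 e' |y| <= 9 e' |h|. *)
have [e' [e'0 e'1 e'9]] : exists e', [/\ 0 < e', e' <= 1 & e' * 9 <= e].
  exists (Num.min 1 (e / 9)); rewrite -ler_pdivlMr // !ge_min !lexx orbT.
  by rewrite lt_min ltr01 divr_gt0.
have /has_derivP/(_ _ e'0)[d1 d10 H1] := @is_derive_expR R 0.
have /has_derivP/(_ _ e'0)[d2 d20 H2] := @is_derive_cos R 0.
have /has_derivP/(_ _ e'0)[d3 d30 H3] := @is_derive_sin R 0.
exists (Num.min (Num.min d1 d2) (Num.min d3 e')).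
  by rewrite !lt_min d10 d20 d30 e'0.
move=> h; rewrite !lt_min -andbA => /and4P[hd1 hd2 hd3 he].
rewrite add0r cexp0 mul1r.
set x := Re h; set y := Im h.
have xh : `|x| <= normc h := Re_le_normc h.
have yh : `|y| <= normc h := Im_le_normc h.
have := H1 x (le_lt_trans xh hd1).
have := H2 y (le_lt_trans yh hd2).
have := H3 y (le_lt_trans yh hd3).
rewrite !add0r expR0 sin0 cos0 oppr0 !mul1r mul0r subr0 addr0 => hs hc hx.
apply: le_trans (normc_le_ReIm _) _.
have -> : Re (cexp h - 1 - h) = expR x * cos y - 1 - x.
  by rewrite /x /y; case: (h).
have -> : Im (cexp h - 1 - h) = expR x * sin y - y.
  by rewrite /x /y; case: (h) => a b /=; rewrite subr0.
have x1 : `|x| <= 1 by rewrite (le_trans xh) // (le_trans (ltW he)).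
have xe : `|x| <= e' by rewrite (le_trans xh) // ltW.
have ex2 : `|expR x - 1| <= 2 * `|x|.
  rewrite -[X in `|X|](subrK x) (le_trans (ler_normD _ _)) //.
  have := ler_wpM2r (normr_ge0 x) e'1; lra.
have ex3 : expR x <= 3 by move: ex2; rewrite ler_norml => /andP[]; lra.
have ex0 := expR_ge0 x.
have A : `|expR x * cos y - 1 - x| <= e' * `|x| + 3 * (e' * `|y|).
  have -> : expR x * cos y - 1 - x = (expR x - 1 - x) + expR x * (cos y - 1).
    by ring.
  rewrite (le_trans (ler_normD _ _)) // lerD // normrM ger0_norm //.
  exact: ler_pM.
have B : `|expR x * sin y - y| <= 3 * (e' * `|y|) + 2 * e' * `|y|.
  have -> : expR x * sin y - y = expR x * (sin y - y) + (expR x - 1) * y.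
    by ring.
  rewrite (le_trans (ler_normD _ _)) // lerD //.
    by rewrite normrM ger0_norm // ler_pM.
  rewrite normrM ler_wpM2r // (le_trans ex2) // ler_wpM2l //.
apply: le_trans (lerD A B) _.
have ex : e' * `|x| <= e' * normc h by rewrite ler_wpM2l // ltW.
have ey : e' * `|y| <= e' * normc h by rewrite ler_wpM2l // ltW.
have := ler_wpM2r (normc_ge0 h) e'9.
by lra.
Qed.

Lemma has_deriv_cexp z : has_deriv cexp z (cexp z).
Proof.
move=> e e0; have z0 : 0 < `|cexp z| by rewrite normr_gt0 cexp_neq0.
have [d d0 dP] := has_deriv_cexp0 (divr_gt0 e0 z0).
exists d => // h /dP; rewrite add0r cexp0 mul1r => H.
have -> : cexp (z + h) - cexp z - cexp z * h = cexp z * (cexp h - 1 - h).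
  by rewrite cexpD !mulrBr mulr1.
rewrite normrM; apply: le_trans (ler_wpM2l (ltW z0) H) _.
by rewrite mulrA mulrCA divff ?mulr1 // gt_eqF.
Qed.

End ComplexExponential.

(** * The derivative at the centre of the disk *)

Section DerivativeAtCentre.
Variable R : realType.
Implicit Types (k : R[i] -> R[i]) (z c : R[i]).

Lemma has_deriv_cauchy_riemann (f : R[i] -> R[i]) c x y :
  has_deriv f (x +i* y) c ->
  cauchy_riemann (fun s t => Re (f (s +i* t)))
    (fun s t => Im (f (s +i* t))) x y.
Proof.
move=> /has_deriv_normc H; exists (Re c), (Im c) => e e0.
have [d d0 dP] := H e e0; exists (d / 2); first by rewrite divr_gt0.
move=> h k hd kd; pose w := h +i* k.
have nw : normc w <= `|h| + `|k| := normc_le_ReIm w.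
have : normc w < d by rewrite (le_lt_trans nw) //; lra.
move=> /dP nP.
have le : e * normc w <= e * (`|h| + `|k|) by rewrite ler_pM2l.
have -> : (x + h) +i* (y + k) = (x +i* y) + w by [].
split; apply: le_trans le; apply: le_trans nP.
- apply: le_trans (Re_le_normc _); rewrite le_eqVlt; apply/orP; left.
  apply/eqP; congr (`| _ |).
  by case: (f _) => ? ?; case: (f _) => ? ?; case: (c) => ? ? /=; ring.
- apply: le_trans (Im_le_normc _); rewrite le_eqVlt; apply/orP; left.
  apply/eqP; congr (`| _ |).
  by case: (f _) => ? ?; case: (f _) => ? ?; case: (c) => ? ? /=; ring.
Qed.

Lemma rotate_to_norm c : exists2 w : R[i], normc w = 1 & w * c = (normc c)%:C.
Proof.
have [->|c0] := eqVneq c 0; first by exists 1; rewrite ?normc1 // normc0 mulr0.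
have n0 : normc c != 0 by rewrite normc_eq0.
exists ((normc c)%:C / c); last by rewrite mulfVK.
by rewrite normcM normcV normc_real ger0_norm ?normc_ge0 ?divff.
Qed.

(** The derivative at 0 is controlled by comparing the integrals over vertical
    segments of G z = w k (exp z) / exp z, where the unit w makes the
    derivative at 0 a positive number m.  Far to the left, Re G is close to m;
    near the imaginary axis, it is at most 1 / |exp z|.  If m > 1, the integrals
    over two such segments cannot be equal. *)
Theorem normc_deriv0_le1 k c :
  (forall z, normc z < 1 -> exists c, has_deriv k z c) ->
  (forall z, normc z < 1 -> normc (k z) <= 1) ->
  k 0 = 0 -> has_deriv k 0 c -> normc c <= 1.
Proof.
move=> dk k1 k0 kc; rewrite leNgt; apply/negP => c1.
have [w w1 wc] := rotate_to_norm c.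
pose G z := w * k (cexp z) / cexp z.
have G_deriv z : Re z < 0 -> exists b, has_deriv G z b.
  move=> z0; have [b kb] : exists b, has_deriv k (cexp z) b.
    by apply: dk; rewrite normc_cexp -expR0 ltr_expR.
  eexists; apply: has_derivM.
    apply: has_derivM; first exact: has_deriv_cst.
    exact: has_deriv_comp (has_deriv_cexp z) kb.
  by apply: has_derivV; [exact: has_deriv_cexp|exact: cexp_neq0].
pose u s t := Re (G (s +i* t)); pose v s t := Im (G (s +i* t)).
have CR s t : s < 0 -> cauchy_riemann u v s t.
  by move=> s0; have [b /has_deriv_cauchy_riemann] := G_deriv (s +i* t) s0.
have G_le z : Re z < 0 -> normc (G z) <= (expR (Re z))^-1.
  move=> z0; rewrite /G !normcM normcV normc_cexp w1 mul1r.
  rewrite ler_pdivrMr ?expR_gt0 // mulVf ?gt_eqF ?expR_gt0 //.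
  by apply: k1; rewrite normc_cexp -expR0 ltr_expR.
set m := normc c in c1 wc.
pose e := (m - 1) / 4.
have e0 : 0 < e by rewrite divr_gt0 // subr_gt0.
have [d d0 dP] : exists2 d : R, 0 < d &
    forall z, expR (Re z) < d -> normc (G z - m%:C) <= e.
  have /has_deriv_normc/(_ e e0)[d d0 dP] := kc.
  exists d => // z zd; have := dP (cexp z); rewrite normc_cexp => /(_ zd).
  rewrite add0r k0 subr0 -ler_pdivrMr ?expR_gt0 //; apply: le_trans.
  rewrite -(normc_cexp z) -normcV -normcM -wc /G.
  have -> : w * k (cexp z) / cexp z - w * c =
      w * ((k (cexp z) - c * cexp z) / cexp z).
    by field; exact: cexp_neq0.
  by rewrite !normcM w1 mul1r.
(* On the right segment x = x2 = ln r we have Re G <= 1 / r, and r lies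
   strictly between 1 / m and 1, so that 1 / r is still smaller than m. *)
pose r := (1 + m^-1) / 2.
have m0 : 0 < m by lra.
have mV1 : m^-1 < 1 by rewrite invf_lt1.
have mV0 : 0 < m^-1 by rewrite invr_gt0.
have r0 : 0 < r by rewrite /r; lra.
have r1 : r < 1 by rewrite /r; lra.
have rV : r^-1 <= m - 2 * e.
  rewrite -(@ler_pM2r _ r) // mulVf ?gt_eqF // /r /e.
  have : m * m^-1 = 1 by rewrite divff ?gt_eqF.
  nra.
pose x2 := ln r; have x20 : x2 < 0 by rewrite ln_lt0 // r0.
have ex2 : expR x2 = r by rewrite lnK.
(* The left segment, so far to the left that Re G is e-close to m there. *)
pose x1 := Num.min (x2 - 1) (ln (d / 2)).
have x12 : x1 < x2 by rewrite gt_min ltrBlDr ltrDl ltr01.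
have ex1 : expR x1 < d.
  apply: le_lt_trans (_ : d / 2 < d); last by lra.
  by rewrite -[leRHS]lnK ?posrE ?divr_gt0 // ler_expR ge_min lexx orbT.
have pi2 : 0 < pi *+ 2 :> R by rewrite mulrn_wgt0 // pi_gt0.
have on : cauchy_riemann_on u v x1 0 (x2 - x1) (pi *+ 2).
  by move=> s t /andP[_ s2] _; apply: CR; lra.
have x12s : 0 < x2 - x1 by rewrite subr_gt0.
have := goursat x12s pi2 on.
rewrite /boundary_int add0r (_ : x1 + (x2 - x1) = x2); last by ring.
have -> : v ^~ (pi *+ 2) = v ^~ 0.
  by apply/funext => s; rewrite /v /G cexp_period.
rewrite [X in _ + X]subrr addr0 => I0.
have [cv cu] := cauchy_riemann_on_continuous on.
have cu1 : {in `[0, pi *+ 2], continuous (u x1)}.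
  by rewrite -[pi *+ 2]add0r; apply: cu; rewrite lexx lerDl ltW.
have cu2 : {in `[0, pi *+ 2], continuous (u x2)}.
  rewrite -[pi *+ 2]add0r; apply: cu.
  by rewrite [x1 + _]addrC subrK lexx ltW.
(* All the values of Re G on the right segment minus Re G on the left one lie
   between lo and hi, and hi is negative. *)
pose lo := - r^-1 - m - e; pose hi := r^-1 - m + e.
have := @int_onB_near_const _ (u x2) (u x1) 0 (pi *+ 2) ((lo + hi) / 2)
  ((hi - lo) / 2) (ltW pi2) cu2 cu1.
rewrite I0 sub0r normrN subr0 normrM [`|pi *+ 2|]gtr0_norm // ler_pM2r //.
suff hyp : forall t, 0 <= t <= pi *+ 2 ->
    `|u x2 t - u x1 t - (lo + hi) / 2| <= (hi - lo) / 2.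
  have hi0 : hi < 0 by rewrite /hi; clear -rV e0; lra.
  move=> /(_ hyp); rewrite ler_norml => /andP[+ _].
  by move: lo hi hi0 {hyp}; clear => lo hi; lra.
move=> t _.
have := G_le (x2 +i* t) x20; rewrite [Re _]/= ex2.
move=> /(le_trans (Re_le_normc _)); rewrite -/(u x2 t) ler_norml => /andP[].
have := dP (x1 +i* t) ex1 => /(le_trans (Re_le_normc _)).
have -> : Re (G (x1 +i* t) - m%:C) = u x1 t - m by rewrite /u; case: (G _).
rewrite !ler_norml => /andP[] + + + +.
move: (u x1 t) (u x2 t); rewrite /lo /hi; clear => a b ? ? ? ?.
by apply/andP; split; lra.
Qed.

End DerivativeAtCentre.

(** * The Schwarz lemma *)

Section Schwarz.
Variable R : realType.
Implicit Types (k : R[i] -> R[i]) (a b c z : R[i]).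

Lemma sqr_normc z : normc z ^+ 2 = Re z ^+ 2 + Im z ^+ 2.
Proof. by case: z => x y /=; rewrite sqr_sqrtr // addr_ge0 ?sqr_ge0. Qed.

Lemma mul_conjc z : z * conjc z = (normc z ^+ 2)%:C.
Proof.
by rewrite sqr_normc; case: z => x y; simpc; congr Complex; ring.
Qed.

Definition disk_moebius b z := (z - b) / (1 - conjc b * z).

(** The one-dimensional case of [ball_moebius_hsq], for a complex b: it makes
    [disk_moebius] a self-map of the disk. *)
Lemma normc_moebius b z :
  normc (1 - conjc b * z) ^+ 2 - normc (z - b) ^+ 2 =
  (1 - normc b ^+ 2) * (1 - normc z ^+ 2).
Proof.
by rewrite !sqr_normc; case: b z => [b1 b2] [z1 z2] /=; ring.
Qed.

Lemma sqr_normc_lt1 z : (normc z ^+ 2 < 1) = (normc z < 1).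
Proof. by rewrite expr_lt1 // normc_ge0. Qed.

Lemma moebius_den_neq0 b z : normc b < 1 -> normc z < 1 -> 1 - conjc b * z != 0.
Proof.
rewrite -(sqr_normc_lt1 b) -(sqr_normc_lt1 z) => b1 z1.
have : 0 < (1 - normc b ^+ 2) * (1 - normc z ^+ 2).
  by rewrite mulr_gt0 ?subr_gt0.
 rewrite -normc_moebius -normc_eq0.
by case: eqP => // ->; rewrite expr0n sub0r oppr_gt0 ltNge sqr_ge0.
Qed.

Lemma disk_moebius_lt1 b z : normc b < 1 -> normc z < 1 ->
  normc (disk_moebius b z) < 1.
Proof.
move=> b1 z1; have den := moebius_den_neq0 b1 z1.
rewrite normcM normcV ltr_pdivrMr; last first.
  by rewrite lt_neqAle normc_ge0 eq_sym normc_eq0 den.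
rewrite mul1r -(@ltr_pXn2r _ 2) ?nnegrE ?normc_ge0 // -subr_gt0 normc_moebius.
by rewrite mulr_gt0 // subr_gt0 sqr_normc_lt1.
Qed.

Lemma disk_moebius_deriv b z : normc b < 1 -> normc z < 1 ->
  has_deriv (disk_moebius b) z
    ((1 - conjc b * b) / (1 - conjc b * z) ^+ 2).
Proof.
move=> b1 z1; have den := moebius_den_neq0 b1 z1.
have num : has_deriv (fun x => x - b) z (1 + 0).
  exact: has_derivD (has_deriv_id z) (has_deriv_cst (- b) z).
have lin : has_deriv (fun x => 1 - conjc b * x) z (- conjc b).
  have -> : (fun x => 1 - conjc b * x) = (fun x => 1 + - conjc b * x).
    by apply/funext => x; rewrite mulNr.
  have := has_derivD (has_deriv_cst 1 z)
    (has_derivM (has_deriv_cst (- conjc b) z) (has_deriv_id z)).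
  by rewrite [X in has_deriv _ _ X -> _](_ : _ = - conjc b) //; ring.
have := has_derivM num (has_derivV lin den).
rewrite (_ : _ + _ * _ = (1 - conjc b * b) / (1 - conjc b * z) ^+ 2) //.
by field.
Qed.

(** Moving a and k a to 0 by disk automorphisms reduces the inequality to
    [normc_deriv0_le1]. *)
Theorem schwarz_pick k a c :
  (forall z, normc z < 1 -> exists c, has_deriv k z c) ->
  (forall z, normc z < 1 -> normc (k z) < 1) ->
  normc a < 1 -> has_deriv k a c ->
  normc c * (1 - normc a ^+ 2) <= 1 - normc (k a) ^+ 2.
Proof.
move=> dk k1 a1 kc; set b := k a; have b1 : normc b < 1 by exact: k1.
have Na1 : normc (- a) < 1 by rewrite normcN.
have phi1 z : normc z < 1 -> normc (disk_moebius (- a) z) < 1.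
  exact: disk_moebius_lt1.
pose psi z := disk_moebius b (k (disk_moebius (- a) z)).
have phi0 : disk_moebius (- a) 0 = a.
  by rewrite /disk_moebius mulr0 subr0 divr1 opprK add0r.
have n0 : normc (0 : R[i]) < 1 by rewrite normc0.
have den := moebius_den_neq0 b1 b1.
have dpsi : has_deriv psi 0 (c * (1 - normc a ^+ 2)%:C / (1 - normc b ^+ 2)%:C).
  have -> : c * (1 - normc a ^+ 2)%:C / (1 - normc b ^+ 2)%:C =
    (1 - conjc b * b) / (1 - conjc b * b) ^+ 2 *
    (c * ((1 - conjc (- a) * (- a)) / (1 - conjc (- a) * 0) ^+ 2)).
    rewrite !rmorphB /= -!mul_conjc mulr0 subr0 expr1n divr1 rmorphN mulrNN.
    by rewrite [conjc a * a]mulrC [b * _]mulrC rmorph1; field.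
  have inner := @has_deriv_comp _ _ k _ _ c (disk_moebius_deriv Na1 n0).
  rewrite phi0 in inner.
  apply: (@has_deriv_comp _ _ (disk_moebius b) _ _ _ (inner kc)).
  by rewrite phi0; exact: disk_moebius_deriv.
have pos z : normc z < 1 -> 0 < 1 - normc z ^+ 2.
  by move=> z1; rewrite subr_gt0 sqr_normc_lt1.
have normcR (x : R) : 0 < x -> normc x%:C = x.
  by move=> x0; rewrite normc_real gtr0_norm.
have := normc_deriv0_le1 _ _ _ dpsi.
rewrite !normcM normcV !normcR ?pos //.
rewrite ler_pdivrMr ?pos // mul1r; apply.
- move=> z z1; have [c' kc'] := dk _ (phi1 z z1).
  eexists; apply: (@has_deriv_comp _ (fun z => k (disk_moebius (- a) z))).
    apply: has_deriv_comp kc'; exact: disk_moebius_deriv.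
  by apply: disk_moebius_deriv => //; apply: k1; exact: phi1.
- by move=> z z1; apply/ltW/disk_moebius_lt1 => //; apply: k1; exact: phi1.
- by rewrite /psi phi0 /disk_moebius -/b subrr mul0r.
Qed.

Lemma Re_deriv k c (t : R) : has_deriv k t%:C c ->
  has_deriv (fun s : R => Re (k s%:C)) t (Re c).
Proof.
move=> /has_deriv_normc H e /H[d d0 dP]; exists d => // h hd.
have := dP h%:C; rewrite normc_real => /(_ hd); apply: le_trans.
apply: le_trans (Re_le_normc _); rewrite le_eqVlt; apply/orP; left; apply/eqP.
congr (`| _ |); rewrite -rmorphD /=.
by case: (k _) => ? ?; case: (k _) => ? ?; case: (c) => ? ? /=; ring.
Qed.

(** The Schwarz-Pick inequality is integrated along the radius [0, 1).  The
    quotient q used for this is the image of p under the disk automorphism that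
    moves t to 0; its derivative has the sign of p' (1 - t^2) - (1 - p^2). *)
Section OnTheRadius.
Variable k : R[i] -> R[i].
Hypothesis dk : forall z, normc z < 1 -> exists c, has_deriv k z c.
Hypothesis k1 : forall z, normc z < 1 -> normc (k z) < 1.
Hypothesis k0 : k 0 = 0.

Let p (t : R) := Re (k t%:C).

Let normcR (t : R) : 0 <= t -> normc t%:C = t.
Proof. by move=> t0; rewrite normc_real ger0_norm. Qed.

Let p_bound t : 0 <= t < 1 -> `|p t| < 1.
Proof.
move=> /andP[t0 t1]; apply: le_lt_trans (Re_le_normc _) (k1 _).
by rewrite normcR.
Qed.

Let den_gt0 t : 0 <= t < 1 -> 0 < 1 - p t * t.
Proof.
move=> t01; have := p_bound t01; rewrite ltr_norml => /andP[? ?].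
by move: t01 => /andP[? ?]; nra.
Qed.

Let q t := (p t - t) * (1 - p t * t)^-1.

Let q_deriv t : 0 <= t < 1 -> exists2 b, b <= 0 & has_deriv q t b.
Proof.
move=> t01; have den := den_gt0 t01; have den0 := gt_eqF den.
have t1 : normc t%:C < 1 by move: t01 => /andP[t0]; rewrite normcR.
have [c kc] := dk t1; have pc := Re_deriv kc.
have sp := schwarz_pick dk k1 t1 kc.
have num : has_deriv (fun s => p s - s) t (Re c - 1).
  have -> : (fun s => p s - s) = (fun s => p s + -1 * s).
    by apply/funext => s; rewrite mulN1r.
  have -> : Re c - 1 = Re c + (0 * t + -1 * 1) by ring.
  apply: has_derivD pc _.
  exact: has_derivM (has_deriv_cst (-1) t) (has_deriv_id t).
have lin : has_deriv (fun s => 1 - p s * s) t (- (Re c * t + p t)).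
  have -> : (fun s => 1 - p s * s) = (fun s => 1 + -1 * (p s * s)).
    by apply/funext => s; rewrite mulN1r.
  have -> : - (Re c * t + p t) =
      0 + (0 * (p t * t) + -1 * (Re c * t + p t * 1)).
    by ring.
  apply: has_derivD (has_deriv_cst 1 t) _.
  apply: has_derivM (has_deriv_cst (-1) t) _.
  exact: has_derivM pc (has_deriv_id t).
have H := has_derivM num (has_derivV lin (negbT den0)).
eexists; last exact: H.
have -> : (Re c - 1) * (1 - p t * t)^-1 +
   (p t - t) * (- - (Re c * t + p t) / (1 - p t * t) ^+ 2) =
   (Re c * (1 - t ^+ 2) - (1 - p t ^+ 2)) / (1 - p t * t) ^+ 2.
  by field; rewrite den0.
rewrite ler_pdivrMr ?exprn_gt0 // mul0r subr_le0.
move: t01 => /andP[t0 t1']; rewrite normcR // in sp.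
have c1 : Re c * (1 - t ^+ 2) <= normc c * (1 - t ^+ 2).
  rewrite ler_wpM2r ?subr_ge0 ?expr_le1 //; first exact: ltW.
  exact: le_trans (ler_norm _) (Re_le_normc c).
apply: le_trans c1 (le_trans sp _).
by rewrite lerD2l lerN2 sqr_normc lerDl sqr_ge0.
Qed.

Let q_nonincreasing s t : 0 <= s -> s <= t -> t < 1 -> q t <= q s.
Proof.
move=> s0 st t1.
have dq x : 0 <= x < 1 -> derivable q x 1 /\ derive1 q x <= 0.
  by move=> /q_deriv[b b0 /has_derivP[dqx qb]]; rewrite derive1E qb.
apply: (@ler0_derive1_le_cc _ q s t) => //; rewrite ?in_itv /= ?lexx ?st //.
- move=> x; rewrite in_itv /= => /andP[? ?].
  by have [] := dq x; [apply/andP; split; lra|].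
- move=> x; rewrite in_itv /= => /andP[? ?].
  by have [] := dq x; [apply/andP; split; lra|].
- apply: derivable_within_continuous => x; rewrite in_itv /= => /andP[? ?].
  by have [] := dq x; [apply/andP; split; lra|].
Qed.

Lemma schwarz_Re t : 0 <= t < 1 -> Re (k t%:C) <= t.
Proof.
move=> t01; have /andP[t0 t1] := t01.
have := q_nonincreasing (lexx 0) t0 t1.
rewrite /q {3 4}/p k0 subrr mul0r pmulr_lle0 ?subr_le0 //.
by rewrite invr_gt0 den_gt0.
Qed.

(** A nonincreasing function that vanishes at 0 and is nonnegative at t
    vanishes on [0, t]. *)
Lemma schwarz_Re_rigid s t : 0 <= s -> s <= t -> t < 1 ->
  t <= Re (k t%:C) -> Re (k s%:C) = s.
Proof.
move=> s0 st t1 kt; apply/eqP; rewrite eq_le.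
rewrite schwarz_Re ?s0 ?(le_lt_trans st) //=.
have s1 : 0 <= s < 1 by rewrite s0 (le_lt_trans st).
have t01 : 0 <= t < 1 by rewrite (le_trans s0).
have : 0 <= q s.
  apply: le_trans (q_nonincreasing s0 st t1).
  by rewrite mulr_ge0 ?subr_ge0 // invr_ge0 ltW // den_gt0.
by rewrite pmulr_lge0 ?subr_ge0 // invr_gt0 den_gt0.
Qed.

End OnTheRadius.
End Schwarz.

(** * Automorphisms fixing the centre are unitary *)

Section SchwarzBall.
Variables (R : realType) (d : nat).
Local Notation C := (R[i]).
Implicit Types (u v w z : 'cV[C]_d) (F : 'cV[C]_d -> 'cV[C]_d).

Definition vnorm z : R := Num.sqrt (Re (hsq z)).

Lemma vnorm_ge0 z : 0 <= vnorm z. Proof. exact: sqrtr_ge0. Qed.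

Lemma vnormE z : (vnorm z ^+ 2)%:C = hsq z.
Proof.
have := hsq_ge0 z; rewrite lecE /= => /andP[/eqP im re].
by rewrite sqr_sqrtr // RRe_real // ger0_real // hsq_ge0.
Qed.

Lemma vnorm_lt1 z : (hsq z < 1) = (vnorm z < 1).
Proof.
by rewrite -vnormE -(rmorph1 (real_complex R)) ltcR expr_lt1 // vnorm_ge0.
Qed.

Lemma hsq_scale_unit (x : C) u : hsq u = 1 -> hsq (x *: u) = (normc x ^+ 2)%:C.
Proof. by move=> u1; rewrite hsqZ u1 mulr1 normcE rmorphXn. Qed.

Lemma normalize z : 0 < vnorm z ->
  exists2 u, hsq u = 1 & z = (vnorm z)%:C *: u.
Proof.
move=> r0; exists ((vnorm z)^-1%:C *: z).
  rewrite hsqZ -vnormE normcE normc_real -rmorphXn -rmorphM.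
  by rewrite real_normK ?num_real // -exprMn mulVf ?gt_eqF // expr1n rmorph1.
by rewrite scalerA -rmorphM divff ?gt_eqF // rmorph1 scale1r.
Qed.

(** Schwarz lemma for holomorphic self-maps of the ball, through the slices
    x |-> <F (x u), w> with unit vectors u and w proportional to z and F z: for
    these, the value of the slice at |z| is |F z|. *)
Section Slices.
Variable F : 'cV[C]_d -> 'cV[C]_d.
Hypothesis dF : holomorphic_on_ball F.
Hypothesis F1 : forall z, hsq z < 1 -> hsq (F z) < 1.
Hypothesis F0 : F 0 = 0.

Section Slice.
Variables u w : 'cV[C]_d.
Hypotheses (u1 : hsq u = 1) (w1 : hsq w = 1).
Let k x := hdot (F (x *: u)) w.

Let disk_ball x : normc x < 1 -> hsq (x *: u) < 1.
Proof.
move=> x1; rewrite hsq_scale_unit // -(rmorph1 (real_complex R)) ltcR.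
by rewrite expr_lt1 // normc_ge0.
Qed.

Lemma slice_has_deriv x : normc x < 1 -> exists c, has_deriv k x c.
Proof. by move=> /disk_ball; exact: holomorphic_slice. Qed.

Lemma slice_le x : normc (k x) <= vnorm (F (x *: u)).
Proof.
have := hdot_le (F (x *: u)) w1.
rewrite -vnormE normcE -rmorphXn lecR ler_pXn2r ?nnegrE ?normc_ge0 //.
exact: vnorm_ge0.
Qed.

Lemma slice_lt1 x : normc x < 1 -> normc (k x) < 1.
Proof.
move=> /disk_ball/F1; rewrite vnorm_lt1; apply: le_lt_trans; exact: slice_le.
Qed.

Lemma slice0 : k 0 = 0.
Proof. by rewrite /k scale0r F0 -(scale0r (0 : 'cV[C]_d)) hdotZl mul0r. Qed.

End Slice.

Lemma schwarz_ball z : hsq z < 1 -> vnorm (F z) <= vnorm z.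
Proof.
move=> z1; have := vnorm_ge0 (F z); rewrite le_eqVlt => /predU1P[<-|s0].
  exact: vnorm_ge0.
have r0 : 0 < vnorm z.
  rewrite lt_neqAle vnorm_ge0 andbT; apply/eqP => r0.
  have z0 : z = 0 by apply: hsq_eq0; rewrite -vnormE -r0 expr0n.
  move: s0; rewrite z0 F0 -[0 : 'cV_d](scale0r (0 : 'cV[C]_d)).
  by rewrite /vnorm hsqZ normr0 expr0n mul0r sqrtr0 ltxx.
have [u u1 zu] := normalize r0; have [w w1 Fw] := normalize s0.
have r01 : 0 <= vnorm z < 1 by rewrite vnorm_ge0 -vnorm_lt1.
have := schwarz_Re (slice_has_deriv w u1) (slice_lt1 u1 w1) (slice0 u w) r01.
by rewrite -zu {1}Fw hdotZl hdot_hsq w1 mulr1.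
Qed.

(** By rigidity the slice takes the value t at t = a |z|.  As the point
    y = F (t u) has norm at most t, the equality case of the Cauchy-Schwarz
    inequality gives y = t w. *)
Lemma schwarz_ball_radial z (a : R) : hsq z < 1 -> vnorm (F z) = vnorm z ->
  0 <= a <= 1 -> F (a%:C *: z) = a%:C *: F z.
Proof.
move=> z1 Fz /andP[a0 a1].
have := vnorm_ge0 z; rewrite le_eqVlt => /predU1P[r0|r0].
  have n0 v : vnorm v = 0 -> v = 0.
    by move=> v0; apply: hsq_eq0; rewrite -vnormE v0 expr0n.
  by rewrite [F z]n0 ?Fz // [z]n0 // !scaler0.
have s0 : 0 < vnorm (F z) by rewrite Fz.
have [u u1 zu] := normalize r0; have [w w1 Fw] := normalize s0.
rewrite vnorm_lt1 in z1.
pose t := a * vnorm z.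
have tz : a%:C *: z = t%:C *: u by rewrite {1}zu scalerA -rmorphM.
have t0 : 0 <= t by rewrite mulr_ge0 // ltW.
have tr : t <= vnorm z by rewrite ler_piMl // ltW.
have nt : normc t%:C = t by rewrite normc_real ger0_norm.
have vt : vnorm (t%:C *: u) = t.
  by rewrite /vnorm hsq_scale_unit // nt sqrtr_sqr ger0_norm.
have kr : vnorm z <= Re (hdot (F ((vnorm z)%:C *: u)) w).
  by rewrite -zu Fw hdotZl hdot_hsq w1 mulr1 /= Fz.
have := schwarz_Re_rigid (slice_has_deriv w u1) (slice_lt1 u1 w1) (slice0 u w)
  t0 tr z1 kr.
rewrite tz; set y := F (t%:C *: u) => Rek.
have yt : vnorm y <= t.
  rewrite -[leRHS]vt; apply: schwarz_ball.
  by rewrite vnorm_lt1 vt (le_lt_trans tr).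
have kt : normc (hdot y w) <= t := le_trans (slice_le u w1 _) yt.
have kE : hdot y w = t%:C.
  have : Im (hdot y w) ^+ 2 <= 0.
    have : normc (hdot y w) ^+ 2 <= t ^+ 2.
      by rewrite ler_pXn2r ?nnegrE ?normc_ge0.
    by rewrite sqr_normc Rek gerDl.
  rewrite real_exprn_even_le0 ?num_real //= => /eqP Imk.
  by apply/eqP; rewrite eq_complex Rek Imk !eqxx.
have : hsq (y - hdot y w *: w) = 0.
  apply/eqP; rewrite eq_le hsq_ge0 andbT hsq_orthogonal_part // kE.
  rewrite -vnormE normcE nt -rmorphXn -rmorphB -(rmorph0 (real_complex R)) lecR.
  by rewrite subr_le0 ler_pXn2r ?nnegrE ?vnorm_ge0.
move/hsq_eq0/eqP; rewrite subr_eq0 => /eqP ->.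
by rewrite kE Fw scalerA -rmorphM Fz.
Qed.

End Slices.

Lemma has_deriv_homogeneous (f : C -> C) b c : has_deriv f 0 c -> f 0 = 0 ->
  (forall a : R, 0 <= a <= 1 -> f a%:C = a%:C * b) -> b = c.
Proof.
move=> /has_deriv_normc fc f0 fb; apply/eqP; rewrite -subr_eq0 -normc_eq0.
rewrite eq_le normc_ge0 andbT; apply/ler_addgt0Pl => e e0; rewrite addr0.
have [r r0 rP] := fc e e0; pose a := Num.min 1 (r / 2).
have a0 : 0 < a by rewrite lt_min ltr01 divr_gt0.
have na : normc a%:C = a by rewrite normc_real gtr0_norm.
have := rP a%:C; rewrite na add0r f0 subr0 fb; last first.
  by rewrite ltW //= ge_min lexx.
rewrite mulrC -mulrBl normcM na ler_pM2r //; apply.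
by rewrite gt_min; apply/orP; right; lra.
Qed.

(** H. Cartan's uniqueness theorem for the ball.  The hypothesis that the
    inverse is holomorphic is what turns the inequality |f z| <= |z| into an
    equality. *)
Theorem Aut_fixing_centre_unitary (f : ball_map C d) : Aut_ball C d f ->
  (forall p, \val p = 0 -> \val (f p) = 0) -> unitary_ball_maps C d f.
Proof.
move=> [[F [Ff dF]] [g [[G [Gg dG]] fK gK]]] f0.
have zero1 : hsq (0 : 'cV[C]_d) < 1 by rewrite hsq0 ltr01.
pose o := ball_point zero1.
have FE z (zB : hsq z < 1) : F z = \val (f (ball_point zB)).
  exact: (Ff (ball_point zB)).
have GE z (zB : hsq z < 1) : G z = \val (g (ball_point zB)).
  exact: (Gg (ball_point zB)).
have F0 : F 0 = 0 by rewrite (FE _ zero1) f0.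
have G0 : G 0 = 0.
  have fo : f o = o by apply: val_inj; rewrite f0.
  by rewrite (GE _ zero1) -/o -{1}fo fK.
have F1 z : hsq z < 1 -> hsq (F z) < 1.
  by move=> zB; rewrite (FE _ zB); exact: hsq_val.
have G1 z : hsq z < 1 -> hsq (G z) < 1.
  by move=> zB; rewrite (GE _ zB); exact: hsq_val.
have GF z : hsq z < 1 -> G (F z) = z.
  by move=> zB; rewrite (FE _ zB) Gg fK.
have FN z : hsq z < 1 -> vnorm (F z) = vnorm z.
  move=> zB; apply/eqP; rewrite eq_le schwarz_ball //=.
  by rewrite -{1}(GF _ zB) schwarz_ball // F1.
have [A AP] := holomorphic_linearization dF.
have FA z : hsq z < 1 -> F z = A *m z.
  move=> zB; apply/colP => i.
  apply: has_deriv_homogeneous (AP z i) _ _; first by rewrite scale0r F0 mxE.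
  move=> a a01; rewrite (schwarz_ball_radial dF F1 F0 zB (FN _ zB) a01).
  by rewrite mxE.
exists A; last by move=> p; rewrite -Ff FA //; exact: hsq_val.
apply: hsq_preserving_unitary => z.
have [r0|r0] := eqVneq (vnorm z) 0.
  have -> : z = 0 by apply: hsq_eq0; rewrite -vnormE r0 expr0n.
  by rewrite mulmx0.
have rp : 0 < vnorm z by rewrite lt_neqAle eq_sym r0 vnorm_ge0.
have [u u1 ->] := normalize rp; rewrite -scalemxAr !hsqZ; congr (_ * _).
(* The matrix A is known to preserve the norm inside the ball only, hence the
   scaling of the unit vector u by a number of modulus less than 1. *)
have [x x0 x1] : exists2 x : C, x != 0 & `|x| ^+ 2 < 1.
  exists 2^-1; first by rewrite invr_eq0 pnatr_eq0.
  rewrite normcE normcV -rmorphXn -(rmorph1 (real_complex R)) ltcR.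
  have -> : (2 : C) = (2 : R)%:C by rewrite rmorph_nat.
  rewrite normc_real ger0_norm //; lra.
have xu : hsq (x *: u) < 1 by rewrite hsqZ u1 mulr1.
have xu_norm : vnorm (A *m (x *: u)) = vnorm (x *: u) by rewrite -(FA _ xu) FN.
have xx : `|x| ^+ 2 != 0 by rewrite expf_eq0 negb_and normr_eq0 x0 orbT.
by apply: (mulfI xx); rewrite -!hsqZ scalemxAr -!vnormE xu_norm.
Qed.

End SchwarzBall.

(** * Maximality *)

Section Maximality.
Variables (R : realType) (d : nat) (i0 : 'I_d).
Hypothesis i00 : i0 = 0%N :> nat.
Local Notation C := (R[i]).
Local Notation Aut := (Aut_ball C d).
Local Notation Unitary := (unitary_ball_maps C d).
Implicit Types (f g : ball_map C d) (z : 'cV[C]_d).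

Lemma normC_real (t : R) : `|t%:C| = `|t|%:C :> C.
Proof. by rewrite normcE normc_real. Qed.

Lemma real_complex_lt1 (t : R) : `|t| < 1 -> `|t%:C| < 1 :> C.
Proof. by rewrite normC_real -(rmorph1 (real_complex R)) ltcR. Qed.

Lemma real_complex_real (t : R) : (t%:C : C) \is Num.real.
Proof. by apply/complex_realP; exists t. Qed.

Definition translation (t : R) (t1 : `|t| < 1) : ball_map C d :=
  ball_map_of
    (ball_moebius_ball i0 (real_complex_real t) (real_complex_lt1 t1)).

Lemma translation_Aut t (t1 : `|t| < 1) : Aut (translation t1).
Proof. exact: moebius_Aut. Qed.

Lemma eq_translation s t (s1 : `|s| < 1) (t1 : `|t| < 1) : s = t ->
  translation s1 = translation t1.
Proof. by move=> st; apply: eq_ball_map => p /=; rewrite st. Qed.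

Lemma translationNK t (t1 : `|t| < 1) (tN1 : `|- t| < 1) :
  cancel (translation tN1) (translation t1).
Proof.
move=> p; apply: val_inj => /=.
have := ball_moebiusK i0 (real_complex_real (- t)) (real_complex_lt1 tN1)
  (hsq_val p).
by rewrite -rmorphN opprK.
Qed.

Let axis : 'cV[C]_d := delta_mx i0 0.

Lemma hsq_axis (c : C) : hsq (c *: axis) = `|c| ^+ 2.
Proof.
rewrite hsqZ [hsq _](_ : _ = 1) ?mulr1 // /hsq (bigD1 i0) //= !mxE !eqxx normr1.
by rewrite expr1n big1 ?addr0 // => i /negPf ii; rewrite !mxE ii normr0 expr0n.
Qed.

Lemma ball_moebius_axis (t c : C) :
  ball_moebius i0 t (c *: axis) = ((c + t) / (1 + t * c)) *: axis.
Proof.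
apply/colP => i; rewrite !mxE !eqxx andbT mulr1.
by case: eqP => _; rewrite ?mulr1 // !mulr0 mul0r.
Qed.

Lemma hsq0_lt1 : hsq (0 : 'cV[C]_d) < 1. Proof. by rewrite hsq0 ltr01. Qed.

Let o := ball_point hsq0_lt1.

Lemma unitary_fix f : Unitary f -> f o = o.
Proof. by move=> [A Au fA]; apply: val_inj; rewrite fA mulmx0. Qed.

Lemma translation0 t (t1 : `|t| < 1) : \val (translation t1 o) = t%:C *: axis.
Proof.
rewrite /= -(scale0r axis) ball_moebius_axis mulr0 addr0 divr1 add0r.
by [].
Qed.

(** The polar decomposition g A h of the automorphism group, the translations
    forming the abelian part A. *)
Theorem cartan_decomposition f : Aut f ->
  exists t (t1 : `|t| < 1) g h, [/\ 0 <= t, Unitary g, Unitary h,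
    f = g \o translation t1 \o h & hsq (\val (f o)) = (t ^+ 2)%:C].
Proof.
move=> Af; have [A [c [Au c0 Ac]]] := unitary_to_axis (\val (f o)) i00.
pose t := Re c; have ct : c = t%:C by rewrite RRe_real // ger0_real.
have t0 : 0 <= t by rewrite -lecR -ct.
have ft : hsq (\val (f o)) = (t ^+ 2)%:C.
  rewrite -(unitary_hsq _ Au) Ac hsq_axis ct normC_real.
  by rewrite ger0_norm // rmorphXn.
have t1 : `|t| < 1.
  have := hsq_val (f o); rewrite ft -(rmorph1 (real_complex R)) ltcR.
  by rewrite expr_lt1 // ger0_norm.
have tN1 : `|- t| < 1 by rewrite normrN.
have UA := unitary_map_unitary Au.
have [UA' [UU' UAK UAVK]] := unitary_inverse UA.
pose h := translation tN1 \o (unitary_map Au \o f).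
have hU : Unitary h.
  apply: Aut_fixing_centre_unitary.
    apply: Aut_comp; first exact: translation_Aut.
    by apply: Aut_comp => //; exact: unitary_Aut.
  move=> p p0; have -> : p = o by apply: val_inj.
  rewrite /= Ac ct ball_moebius_axis rmorphN subrr mul0r scale0r.
  by [].
exists t, t1, UA', h; split=> //.
by apply/funext => p /=; rewrite translationNK UAK.
Qed.

Section Subsemigroup.
Variable S : set (ball_map C d).
Hypotheses (SA : S `<=` Aut) (Scomp : forall f g, S f -> S g -> S (f \o g)).
Hypothesis US : Unitary `<=` S.

(** The factors g and h of f = g o translation t o h have unitary inverses,
    which lie in S, so the translation can be isolated inside S. *)
Lemma translation_of_value f t (t1 : `|t| < 1) : S f -> 0 <= t ->
  hsq (\val (f o)) = (t ^+ 2)%:C -> S (translation t1).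
Proof.
move=> Sf t0 ft.
have [s [s1 [g [h [s0 gU hU fE fs]]]]] := cartan_decomposition (SA Sf).
have st : s = t.
  apply/eqP; rewrite -(@eqrXn2 _ 2) //.
  by apply/eqP/complexI; rewrite -[LHS]fs.
have [g' [gU' gK gK']] := unitary_inverse gU.
have [h' [hU' hK hK']] := unitary_inverse hU.
rewrite -(eq_translation s1 t1 st).
have -> : translation s1 = g' \o (f \o h').
  by apply/funext => p; rewrite fE /= hK' gK.
by apply: Scomp; [exact: US|apply: Scomp => //; exact: US].
Qed.

Lemma diag_unitary (u : C) : `|u| = 1 ->
  diag_mx (\row_i if i == i0 then u else 1) \is @unitarymx C d d.
Proof.
move=> u1; apply: hsq_preserving_unitary => z; apply: eq_bigr => i _.
rewrite mul_diag_mx !mxE normrM; case: eqP => _; rewrite ?u1 ?normr1 mul1r //.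
Qed.

Lemma unit_with_Re (c : R) : -1 <= c <= 1 -> exists2 u : C, `|u| = 1 & Re u = c.
Proof.
move=> c1; exists (c +i* Num.sqrt (1 - c ^+ 2)) => //.
have c2 : c ^+ 2 <= 1.
  by rewrite -real_normK ?num_real // expr_le1 // ler_norml.
by rewrite normc_def /= sqr_sqrtr ?subr_ge0 // addrC subrK sqrtr1.
Qed.

(** For a unit u with real part c, the map translation t o D o translation t
    moves the centre to a point whose squared norm N satisfies
    1 - N = (1 - t^2)^2 / (1 + 2 t^2 c + t^4).  Solving for c with N = r^2 gives
    c in [-1, 1] exactly when r (1 + t^2) <= 2 t. *)
Lemma translation_doubling t r (t1 : `|t| < 1) (r1 : `|r| < 1) :
  0 < t -> 0 <= r -> r * (1 + t ^+ 2) <= 2 * t ->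
  S (translation t1) -> S (translation r1).
Proof.
move=> t0 r0 rt St.
have tlt1 : t < 1 by have := t1; rewrite gtr0_norm.
have t2 : t ^+ 2 < 1 by rewrite expr_lt1 // ltW.
have r2 : r ^+ 2 < 1 by have := r1; rewrite ger0_norm // expr_lt1.
pose q := (1 - t ^+ 2) ^+ 2 / (1 - r ^+ 2).
have q_lo : (1 - t ^+ 2) ^+ 2 <= q.
  by rewrite ler_pdivlMr ?subr_gt0 // ler_piMr ?sqr_ge0 // gerBl sqr_ge0.
have q_hi : q <= (1 + t ^+ 2) ^+ 2.
  rewrite ler_pdivrMr ?subr_gt0 //.
  have : (r * (1 + t ^+ 2)) ^+ 2 <= (2 * t) ^+ 2.
    by rewrite ler_pXn2r ?nnegrE ?mulr_ge0 ?addr_ge0 ?sqr_ge0 // ltW.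
  by rewrite !exprMn; lra.
pose c := (q - 1 - t ^+ 4) / (2 * t ^+ 2).
have tt : 0 < 2 * t ^+ 2 by rewrite mulr_gt0 // exprn_gt0.
have cE : 1 + 2 * t ^+ 2 * c + t ^+ 4 = q.
  by rewrite /c; field; rewrite gt_eqF.
have t4 : t ^+ 4 = (t ^+ 2) ^+ 2 by rewrite -exprM.
have c1 : -1 <= c <= 1.
  rewrite /c ler_pdivlMr // ler_pdivrMr //; apply/andP; split; rewrite t4; nra.
have [u u1 uc] := unit_with_Re c1.
have Du := unitary_map_unitary (diag_unitary u1).
apply: (@translation_of_value (translation t1 \o (unitary_map (diag_unitary u1)
   \o translation t1))) => //.
  by apply: Scomp => //; apply: Scomp => //; exact: US.
have -> : \val ((translation t1 \o (unitary_map (diag_unitary u1)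
   \o translation t1)) o) = ball_moebius i0 t%:C ((u * t%:C) *: axis).
  rewrite -[LHS]/(ball_moebius i0 t%:C (_ *m \val (translation t1 o))).
  rewrite translation0; congr ball_moebius; apply/colP => i.
  rewrite mul_diag_mx !mxE; case: eqP => _; rewrite ?andbT ?mulr1 ?mulr0 //.
have ut : hsq ((u * t%:C) *: axis) = (t ^+ 2)%:C.
  by rewrite hsq_axis normrM u1 mul1r normC_real ger0_norm ?ltW // rmorphXn.
have ut1 : hsq ((u * t%:C) *: axis) < 1.
  by rewrite ut -(rmorph1 (real_complex R)) ltcR.
have den : `|1 + t%:C * ((u * t%:C) *: axis) i0 0| ^+ 2 = q%:C.
  have uu : Re u ^+ 2 + Im u ^+ 2 = 1.
    by apply: complexI; rewrite add_Re2_Im2 u1 expr1n.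
  rewrite !mxE !eqxx mulr1 -add_Re2_Im2 -cE -uc; congr (_%:C).
  have -> : t ^+ 4 = t ^+ 4 * (Re u ^+ 2 + Im u ^+ 2) by rewrite uu mulr1.
  by case: (u) => a b /=; ring.
have := ball_moebius_hsq i0 (real_complex_real t) (real_complex_lt1 t1) ut1.
rewrite den ut; set H := hsq _ => HE.
have -> : H = 1 - (1 - H) by ring.
have q0 : 0 < q by apply: lt_le_trans q_lo; rewrite exprn_gt0 // subr_gt0.
rewrite {}HE -rmorphXn -(rmorph1 (real_complex R)) -rmorphB -rmorphM.
rewrite -fmorph_div -rmorphB; congr (_%:C).
rewrite -expr2 /q invf_div mulrCA divff.
  by rewrite mulr1 subKr.
by rewrite expf_neq0 // gt_eqF // subr_gt0.
Qed.

(** The doubling step maps t = 1 - e to 2t / (1 + t^2) >= 1 - e^2.  Hence n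
    steps reach at least 1 - (1 - t)^(n + 1), which tends to 1. *)
Lemma translation_all t (t1 : `|t| < 1) : 0 < t -> S (translation t1) ->
  forall r (r1 : `|r| < 1), 0 <= r -> S (translation r1).
Proof.
move=> t0 St; have tlt1 : t < 1 by have := t1; rewrite gtr0_norm.
have t'0 : 0 < 1 - t by rewrite subr_gt0.
have t'1 : 1 - t < 1 by rewrite gtrBl.
have main n r (r1 : `|r| < 1) : 0 <= r -> (1 - t) ^+ n.+1 <= 1 - r ->
    S (translation r1).
  elim: n r r1 => [|n IHn] r r1 r0 rn.
    apply: (translation_doubling r1 t0 r0 _ St).
    rewrite expr1 in rn; have : r <= t by lra.
    have : t ^+ 2 <= 1 by rewrite expr_le1 ?ltW.
    nra.
  pose e := (1 - t) ^+ n.+1.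
  have e0 : 0 < e by rewrite exprn_gt0.
  have et : e <= 1 - t by rewrite /e exprS ler_piMr ?exprn_ile1 // ltW.
  have s1 : `|1 - e| < 1 by rewrite ger0_norm; lra.
  have s0 : 0 < 1 - e by lra.
  have sn : e <= 1 - (1 - e) by lra.
  apply: (translation_doubling r1 s0 r0 _ (IHn _ s1 (ltW s0) sn)).
  rewrite exprS -/e in rn.
  have ee : e * e <= 1 - r by apply: le_trans rn; rewrite ler_pM2r.
  have : r * (1 + (1 - e) ^+ 2) <= (1 - e * e) * (1 + (1 - e) ^+ 2).
    by rewrite ler_wpM2r ?addr_ge0 ?sqr_ge0 //; lra.
  have : 0 <= (e * (1 - e)) ^+ 2 by rewrite sqr_ge0.
  lra.
move=> r r1 r0; have rlt1 : r < 1 by have := r1; rewrite ger0_norm.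
have t'n : `|1 - t| < 1 by rewrite gtr0_norm.
have r'0 : 0 < 1 - r by rewrite subr_gt0.
have /cvgrPdist_le/(_ (1 - r) r'0)[N _ /(_ N.+1 (leqnSn N))] := cvg_expr t'n.
rewrite /= sub0r normrN ger0_norm ?exprn_ge0 ?(ltW t'0) //.
exact: main.
Qed.

End Subsemigroup.

Theorem unitary_maximal : maximal_subsemigroup Aut Unitary.
Proof.
split.
- by split; [exact: unitary_Aut|exact: unitary_comp].
- split; first exact: unitary_Aut.
  have half1 : `|2^-1 : R| < 1 by rewrite ger0_norm; lra.
  move=> /(_ _ (translation_Aut half1)) /unitary_fix /(congr1 val).
  rewrite [LHS]translation0 /= => /(congr1 (@hsq C d)).
  rewrite hsq_axis hsq0 normC_real -rmorphXn => /complexI /eqP.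
  by rewrite expf_eq0 normr_eq0 invr_eq0 pnatr_eq0.
- move=> S [SA Scomp] [US SU]; apply/seteqP; split=> // f Af.
  have [g Sg gU] : exists2 g, S g & ~ Unitary g.
    apply: contrapT => ng; apply: SU => g Sg.
    by apply: contrapT => gU; apply: ng; exists g.
  have [t [t1 [g1 [g2 [t0 U1 U2 gE gt]]]]] := cartan_decomposition (SA _ Sg).
  have tp : 0 < t.
    rewrite lt_neqAle t0 andbT; apply/eqP => tz; apply: gU.
    apply: Aut_fixing_centre_unitary; first exact: SA.
    move=> p p0; have -> : p = o by apply: val_inj.
    by apply: hsq_eq0; rewrite gt -tz expr0n.
  have St := translation_of_value SA Scomp US t1 Sg t0 gt.
  have [s [s1 [f1 [f2 [s0 V1 V2 -> _]]]]] := cartan_decomposition Af.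
  apply: (Scomp); last exact: US.
  by apply: (Scomp); [exact: US|exact: (translation_all SA Scomp US tp St)].
Qed.

End Maximality.

Theorem proposition9p9 (R : realType) (d : nat) (hd : (1 <= d)%N) :
  maximal_subsemigroup (Aut_ball R[i] d) (unitary_ball_maps R[i] d).
Proof. exact: (@unitary_maximal R d (Ordinal hd)). Qed.
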